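(* Let $(M(E,I),S)$ be a state space, with $E$ totally ordered by $<$. For all $n\ge0$ the groups $H_n(K(S),\Delta\mathbb{Z})$ are isomorphic to the homology groups of the complex $$0\leftarrow\mathbb{Z}S\xleftarrow{d_1}\mathbb{Z}\overline{Q}_1(E,I,S)\xleftarrow{d_2}\mathbb{Z}\overline{Q}_2(E,I,S)\leftarrow\cdots\leftarrow\mathbb{Z}\overline{Q}_{n-1}(E,I,S)\xleftarrow{d_n}\mathbb{Z}\overline{Q}_n(E,I,S)\leftarrow\cdots$$ with differentials $$d_n(s,a_1,\dots,a_n)=\sum_{i=1}^n(-1)^i(s\cdot a_i,a_1,\dots,a_{i-1},a_{i+1},\dots,a_n)-\sum_{i=1}^n(-1)^i(s,a_1,\dots,a_{i-1},a_{i+1},\dots,a_n).$$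
   Context: $\mathrm{Ab}$ is the category of Abelian groups. An independence relation on a set $E$ (possibly infinite) is an irreflexive symmetric relation $I\subseteq E\times E$. The trace monoid $M(E,I)$ is the quotient of the free monoid $E^*$ by the least equivalence relation with $uabv\equiv ubav$ for all $(a,b)\in I$ and $u,v\in E^*$. A state space $(M(E,I),S)$ consists of a trace monoid and a partial right action of it on a set $S$: partial maps $s\mapsto s\cdot w$ on $S$ for $w\in M(E,I)$, with $s\cdot 1=s$ for all $s$, and with $s\cdot(vw)$ defined exactly when $s\cdot v$ and $(s\cdot v)\cdot w$ are defined, in which case $s\cdot(vw)=(s\cdot v)\cdot w$. The state category $K(S)$ has object set $S$; morphisms $s\to s'$ are triples $(s,w,s')$ with $s,s'\in S$, $w\in M(E,I)$, $s\cdot w$ defined and $s\cdot w=s'$; the composite of $(s,v,s')$ followed by $(s',w,s'')$ is $(s,vw,s'')$. $\Delta\mathbb{Z}:K(S)\to\mathrm{Ab}$ is the constant functor with value $\mathbb{Z}$ on objects and $1_{\mathbb{Z}}$ on morphisms. For a small category $\mathscr{C}$ and a functor $F:\mathscr{C}\to\mathrm{Ab}$, $H_n(\mathscr{C},F)$ is the $n$-th left derived functor of the colimit functor $\varinjlim^{\mathscr{C}}:\mathrm{Ab}^{\mathscr{C}}\to\mathrm{Ab}$ evaluated at $F$. For $n\ge0$, $\overline{Q}_n(E,I,S)$ is the set of tuples $(s,a_1,\dots,a_n)$ with $s\in S$ and $a_1,\dots,a_n\in E$ such that $a_i<a_j$ and $(a_i,a_j)\in I$ for all $1\le i<j\le n$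 and $s\cdot(a_1\cdots a_n)$ is defined; in particular $\overline{Q}_0(E,I,S)=S$. For a set $A$, $\mathbb{Z}A$ is the free Abelian group generated by $A$. *)

(* Defs.v *)
From HB Require Import structures.
From mathcomp Require Import all_boot all_order all_algebra.
From mathcomp Require Import boolp zify.
From mathcomp.multinomials Require Import freeg.

Set Implicit Arguments.
Unset Strict Implicit.
Unset Printing Implicit Defensive.

Import Order.TTheory GRing.Theory.
Local Open Scope ring_scope.
Local Open Scope quotient_scope.

Definition isomorphic (A B : zmodType) : Prop :=
  exists f : {additive A -> B}, bijective f.

Section FreeGroup.
Variables (K : choiceType) (A : zmodType) (f : K -> A).

Definition free_gen (k : K) : {freeg K} := << k >>.

(* fglift is stated for modules; zmodule A is A seen as an int-module. *)
Definition free_lift (x : {freeg K}) : A := fglift (f : K -> zmodule A) x.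

Fact free_lift_is_zmod_morphism : zmod_morphism free_lift.
Proof. exact: (lift_is_additive (f : K -> zmodule A)). Qed.

HB.instance Definition _ :=
  GRing.isZmodMorphism.Build {freeg K} A free_lift free_lift_is_zmod_morphism.

Lemma free_liftE k : free_lift (free_gen k) = f k.
Proof. by rewrite /free_lift liftU scalezrE. Qed.

End FreeGroup.

Lemma free_ext (K : choiceType) (A : zmodType) (g h : {additive {freeg K} -> A}) :
  (forall k, g (free_gen k) = h (free_gen k)) -> g =1 h.
Proof.
move=> gh; elim/freeg_ind_dom0 => [|m k D _ _ IH]; first by rewrite !raddf0.
have -> : << m *g k >> = free_gen k *~ m by rewrite freegU_mulz intz.
by rewrite !raddfD /= !raddfMz gh IH.
Qed.

Section Subgroup.
Variables (A : zmodType) (P : zmodClosed A).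

Record subgroup := Subgroup { subgroup_val : A; _ : subgroup_val \in P }.

HB.instance Definition _ := [isSub for subgroup_val].
HB.instance Definition _ := [Choice of subgroup by <:].
HB.instance Definition _ := [SubChoice_isSubZmodule of subgroup by <:].

End Subgroup.

Section KernelImage.
Variables (A B : zmodType) (f : {additive A -> B}).

Definition kerp : {pred A} := fun x => f x == 0.

Fact kernel_zmod_closed : zmod_closed kerp.
Proof.
split=> [|x y /eqP fx /eqP fy]; first by rewrite unfold_in raddf0.
by rewrite unfold_in raddfB fx fy subrr.
Qed.

HB.instance Definition _ := GRing.isZmodClosed.Build A kerp kernel_zmod_closed.

Definition imgp : {pred B} := fun y => `[< exists x, f x = y >].

Fact img_zmod_closed : zmod_closed imgp.
Proof.
split=> [|x y /asboolP[u <-] /asboolP[v <-]]; apply/asboolP.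
  by exists 0; rewrite raddf0.
by exists (u - v); rewrite raddfB.
Qed.

HB.instance Definition _ := GRing.isZmodClosed.Build B imgp img_zmod_closed.

End KernelImage.

Section Preimage.
Variables (A B : zmodType) (f : {additive A -> B}) (P : zmodClosed B).
Definition preim_sub : {pred A} := fun x => f x \in P.
Fact preim_zmod_closed : zmod_closed preim_sub.
Proof.
split=> [|x y fx fy]; first by rewrite unfold_in raddf0 rpred0.
by rewrite unfold_in raddfB rpredB.
Qed.
HB.instance Definition _ := GRing.isZmodClosed.Build A preim_sub preim_zmod_closed.
End Preimage.

Section Generated.
Variables (A : zmodType) (R : A -> Prop).

Inductive generated_by : A -> Prop :=
| GeneratedIn x : R x -> generated_by x
| Generated0 : generated_by 0
| GeneratedB x y : generated_by x -> generated_by y -> generated_by (x - y).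

Definition generated : {pred A} := fun x => `[< generated_by x >].

Fact generated_zmod_closed : zmod_closed generated.
Proof.
split=> [|x y /asboolP Rx /asboolP Ry]; apply/asboolP; first exact: Generated0.
exact: GeneratedB.
Qed.

HB.instance Definition _ :=
  GRing.isZmodClosed.Build A generated generated_zmod_closed.
End Generated.

Record chain_complex := ChainComplex {
  chain :> nat -> zmodType;
  chain_diff : forall n, {additive chain n.+1 -> chain n};
  chain_diffK : forall n (x : chain n.+2), chain_diff n (chain_diff n.+1 x) = 0
}.

Section Homology.
Variables (X : chain_complex) (n : nat).

(* Every element of degree 0 is a cycle: the complex continues with X 0 -> 0. *)
Definition is_cycle : {pred X n} :=
  match n return {pred X n} with
  | 0%N => predT
  | m.+1 => kerp (chain_diff X m)
  end.

Fact cycle_zmod_closed : zmod_closed is_cycle.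
Proof. by rewrite /is_cycle; case: n => [|m] //; exact: kernel_zmod_closed. Qed.
HB.instance Definition _ := GRing.isZmodClosed.Build (X n) is_cycle cycle_zmod_closed.

Definition cycles := subgroup is_cycle.
HB.instance Definition _ := GRing.Zmodule.on cycles.

Definition boundaries : {pred cycles} :=
  preim_sub (val : cycles -> X n) (imgp (chain_diff X n)).

HB.instance Definition _ := GRing.ZmodClosed.on boundaries.

Definition homology : zmodType := {ideal_quot boundaries}.
End Homology.

Arguments is_cycle : clear implicits.
Arguments boundaries : clear implicits.

(* The equations are Leibniz equalities of morphisms; composites are written in
   diagrammatic order. *)
Record category := Category {
  obj :> Type;
  mor : obj -> obj -> Type;
  idm : forall a, mor a a;
  mcomp : forall a b c, mor a b -> mor b c -> mor a c;
  mcomp1m : forall a b (f : mor a b), mcomp (idm a) f = f;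
  mcompm1 : forall a b (f : mor a b), mcomp f (idm b) = f;
  mcompA : forall a b c d (f : mor a b) (g : mor b c) (h : mor c d),
    mcomp f (mcomp g h) = mcomp (mcomp f g) h
}.

Record ab_functor (C : category) := AbFunctor {
  fobj :> C -> zmodType;
  fmap : forall a b : C, mor a b -> {additive fobj a -> fobj b};
  fmap1 : forall a (x : fobj a), fmap (idm a) x = x;
  fmapM : forall a b c (f : mor a b) (g : mor b c) (x : fobj a),
    fmap (mcomp f g) x = fmap g (fmap f x)
}.

Record nat_trans (C : category) (F G : ab_functor C) := NatTrans {
  ncomp :> forall a, {additive F a -> G a};
  naturality : forall (a b : C) (f : mor a b) (x : F a),
    ncomp b (fmap F f x) = fmap G f (ncomp a x)
}.

Section ConstFunctor.
Variables (C : category) (A : zmodType).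

Definition const_functor : ab_functor C :=
  @AbFunctor C (fun=> A) (fun _ _ _ => idfun) (fun _ _ => erefl)
    (fun _ _ _ _ _ _ => erefl).

End ConstFunctor.

Section NatTransComp.
Variables (C : category) (F G H : ab_functor C).

Fact ntrans_comp_natural (t : nat_trans F G) (u : nat_trans G H) a b
    (f : mor a b) (x : F a) :
  u b (t b (fmap F f x)) = fmap H f (u a (t a x)).
Proof. by rewrite !naturality. Qed.

Definition ntrans_comp (t : nat_trans F G) (u : nat_trans G H) : nat_trans F H :=
  @NatTrans C F H (fun a => u a \o t a) (ntrans_comp_natural t u).
End NatTransComp.

Section Colimit.
Variables (C : category).
Implicit Types F G : ab_functor C.

Definition element F := {classic {a : C & F a}}.
Definition elt F a (x : F a) : element F := existT (fun a => F a : Type) a x.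

Variant colim_rel F : {freeg (element F)} -> Prop :=
| ColimAdd a (x y : F a) :
    colim_rel (free_gen (elt (x + y)) - free_gen (elt x) - free_gen (elt y))
| ColimMap a b (f : mor a b) (x : F a) :
    colim_rel (free_gen (elt (fmap F f x)) - free_gen (elt x)).

(* The colimit is presented as the free abelian group on all pairs (a, x) with
   x in F a, modulo additivity in x and (b, F(f) x) = (a, x) for f : a -> b.
   colim_in, colim_in_natural, colim_descE and colim_ext give its universal
   property. *)
Local Notation quot_colim F := {ideal_quot (generated (@colim_rel F))}.

Definition colim F : zmodType := quot_colim F.

Definition colim_in F a (x : F a) : colim F := \pi_(quot_colim F) (free_gen (elt x)).

Lemma colim_eq0 F (x : {freeg (element F)}) : colim_rel x -> \pi_(quot_colim F) x = 0.
Proof.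
move=> Rx; rewrite -(raddf0 (\pi_(quot_colim F))); apply/eqP.
by rewrite -Quotient.idealrBE subr0; apply/asboolP; exact: GeneratedIn.
Qed.

Fact colim_in_is_zmod_morphism F a : zmod_morphism (@colim_in F a).
Proof.
move=> x y; have /colim_eq0/eqP := ColimAdd (x - y) y.
rewrite subrK !raddfB /= subr_eq0 subr_eq => /eqP E.
by rewrite /colim_in E addrAC subrr add0r.
Qed.

HB.instance Definition _ F a :=
  GRing.isZmodMorphism.Build (F a) (colim F) (@colim_in F a)
    (@colim_in_is_zmod_morphism F a).

Lemma colim_in_natural F a b (f : mor a b) (x : F a) :
  colim_in (fmap F f x) = colim_in x.
Proof.
apply/eqP; rewrite -subr_eq0 /colim_in -(raddfB (\pi_(quot_colim F))).
by apply/eqP/colim_eq0; exact: ColimMap.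
Qed.

Section Desc.
Variables (F : ab_functor C) (A : zmodType) (t : nat_trans F (const_functor C A)).

Definition colim_pre (e : element F) : A := let: existT a x := e in t a x.

Definition colim_desc (x : colim F) : A := free_lift colim_pre (repr (x : quot_colim F)).

Lemma colim_desc_pi x : colim_desc (\pi_(quot_colim F) x) = free_lift colim_pre x.
Proof.
rewrite /colim_desc; case: piP => y /eqP.
rewrite -Quotient.idealrBE => /asboolP xy; apply/eqP.
rewrite eq_sym -subr_eq0 -raddfB /=; apply/eqP.
elim: xy => [_ []|| u v _ IHu _ IHv] /=.
- move=> a u v; rewrite !raddfB /= !free_liftE /= raddfD /=.
  by rewrite addrAC addrK subrr.
- by move=> a b f u; rewrite raddfB /= !free_liftE /= naturality subrr.
- by rewrite raddf0.
- by rewrite raddfB /= IHu IHv subrr.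
Qed.

Fact colim_desc_is_zmod_morphism : zmod_morphism colim_desc.
Proof.
move=> x y; rewrite -[x](@reprK _ (quot_colim F)) -[y](@reprK _ (quot_colim F)) -[_ - _](raddfB (\pi_(quot_colim F))).
by rewrite !colim_desc_pi raddfB.
Qed.

HB.instance Definition _ :=
  GRing.isZmodMorphism.Build (colim F) A colim_desc colim_desc_is_zmod_morphism.

Lemma colim_descE a (x : F a) : colim_desc (colim_in x) = t a x.
Proof. by rewrite colim_desc_pi free_liftE. Qed.

End Desc.

Lemma colim_ext F (A : zmodType) (g h : {additive colim F -> A}) :
  (forall a (x : F a), g (colim_in x) = h (colim_in x)) -> g =1 h.
Proof.
move=> gh x; rewrite -[x](@reprK _ (quot_colim F)).
apply: (free_ext (g := g \o \pi_(quot_colim F)) (h := h \o \pi_(quot_colim F))).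
by case=> a y; exact: gh.
Qed.

Section Map.
Variables (F G : ab_functor C) (t : nat_trans F G).

Fact colim_cocone_natural a b (f : mor a b) (x : F a) :
  colim_in (t b (fmap F f x)) = colim_in (t a x).
Proof. by rewrite naturality colim_in_natural. Qed.

Definition colim_cocone : nat_trans F (const_functor C (colim G)) :=
  @NatTrans C F (const_functor C (colim G))
    (fun a => @colim_in G a \o t a) colim_cocone_natural.

Definition colim_map : {additive colim F -> colim G} := colim_desc colim_cocone.

Lemma colim_mapE a (x : F a) : colim_map (colim_in x) = colim_in (t a x).
Proof. exact: colim_descE. Qed.

End Map.
End Colimit.

(* Epimorphisms and exactness in the category of functors C -> Ab are computed
   pointwise. *)
Definition pointwise_surj (C : category) (F G : ab_functor C) (t : nat_trans F G) : Prop :=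
  forall a (y : G a), exists x, t a x = y.

Definition projective (C : category) (P : ab_functor C) : Prop :=
  forall (F G : ab_functor C) (e : nat_trans F G) (t : nat_trans P G),
    pointwise_surj e -> exists u : nat_trans P F, forall a (x : P a), e a (u a x) = t a x.

Definition exact_at (C : category) (F G H : ab_functor C)
    (t : nat_trans F G) (u : nat_trans G H) : Prop :=
  forall a (y : G a), u a y = 0 <-> exists x, t a x = y.

Record projective_resolution (C : category) (F : ab_functor C) := ProjResolution {
  res_obj : nat -> ab_functor C;
  res_diff : forall n, nat_trans (res_obj n.+1) (res_obj n);
  res_aug : nat_trans (res_obj 0) F;
  res_projective : forall n, projective (res_obj n);
  res_aug_surj : pointwise_surj res_aug;
  res_exact0 : exact_at (res_diff 0) res_aug;
  res_exact : forall n, exact_at (res_diff n.+1) (res_diff n)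
}.

Arguments res_projective {C F} p n.
Arguments res_aug_surj {C F} p.
Arguments res_exact0 {C F} p.
Arguments res_exact {C F} p n.

Section ColimComplex.
Variables (C : category) (F : ab_functor C) (P : projective_resolution F).

Fact colim_complex_diffK n (x : colim (res_obj P n.+2)) :
  colim_map (res_diff P n) (colim_map (res_diff P n.+1) x) = 0.
Proof.
pose g : {additive colim (res_obj P n.+2) -> colim (res_obj P n)} :=
  colim_map (res_diff P n) \o colim_map (res_diff P n.+1).
apply: (@colim_ext C _ _ g \0) => a y; rewrite /= !colim_mapE.
by rewrite (_ : res_diff P n a _ = 0) ?raddf0 //; apply/res_exact; exists y.
Qed.

Definition colim_complex : chain_complex :=
  ChainComplex (fun n => colim_complex_diffK (n := n)).

End ColimComplex.

Section FreeCover.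
Variables (C : category) (F : ab_functor C).

Definition free_basis (b : C) := {classic {e : element F & mor (tag e) b}}.

Definition basis_elt (e : element F) b (f : mor (tag e) b) : free_basis b :=
  existT (fun e : element F => mor (tag e) b : Type) e f.

Definition push b c (g : mor b c) (e : free_basis b) : free_basis c :=
  basis_elt (mcomp (tagged e) g).

Definition free_fmap b c (g : mor b c) :
    {additive {freeg (free_basis b)} -> {freeg (free_basis c)}} :=
  free_lift (fun e => free_gen (push g e)).

Fact free_fmap1 b x : free_fmap (idm b) x = x.
Proof.
apply: (free_ext (h := idfun)) => -[e f].
by rewrite [LHS]free_liftE /push /= mcompm1.
Qed.

Fact free_fmapM b c d (g : mor b c) (h : mor c d) x :
  free_fmap (mcomp g h) x = free_fmap h (free_fmap g x).
Proof.
apply: (free_ext (h := free_fmap h \o free_fmap g)) => -[e f].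
by rewrite [LHS]free_liftE [RHS]/= !free_liftE /push /= mcompA.
Qed.

Definition free_cover : ab_functor C := AbFunctor free_fmap1 free_fmapM.

Definition free_eval b (e : free_basis b) : F b := fmap F (tagged e) (tagged (tag e)).

Fact free_cover_natural b c (g : mor b c) (x : free_cover b) :
  free_lift (@free_eval c) (fmap free_cover g x)
  = fmap F g (free_lift (@free_eval b) x).
Proof.
apply: (free_ext (g := free_lift (@free_eval c) \o fmap free_cover g)
  (h := fmap F g \o free_lift (@free_eval b))) => -[e f].
by rewrite /= /free_fmap !free_liftE /free_eval /= fmapM.
Qed.

Definition free_cover_map : nat_trans free_cover F :=
  @NatTrans C free_cover F (fun b => free_lift (@free_eval b)) free_cover_natural.

Lemma free_cover_surj : pointwise_surj free_cover_map.
Proof.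
move=> b y; exists (free_gen (@basis_elt (elt y) b (idm b))).
by rewrite /= free_liftE /free_eval /= fmap1.
Qed.

Lemma free_cover_projective : projective free_cover.
Proof.
move=> G H e t e_epi.
pose l (x : element F) :=
  cid (e_epi _ (t (tag x) (free_gen (basis_elt (idm (tag x)))))).
pose u0 b (x : free_basis b) : G b := fmap G (tagged x) (sval (l (tag x))).
have u_nat b c (g : mor b c) (x : free_cover b) :
    free_lift (@u0 c) (fmap free_cover g x) = fmap G g (free_lift (@u0 b) x).
  apply: (free_ext (g := free_lift (@u0 c) \o fmap free_cover g)
    (h := fmap G g \o free_lift (@u0 b))) => y /=.
  by rewrite [free_fmap _ _]free_liftE !free_liftE /u0 /= fmapM.
exists (@NatTrans C free_cover G (fun b => free_lift (@u0 b)) u_nat) => b x.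
apply: (free_ext (g := e b \o free_lift (@u0 b)) (h := t b)) => -[y f] /=.
rewrite free_liftE /u0 naturality /=; case: (l y) => z /= ->.
rewrite -[LHS](naturality t f (free_gen (basis_elt (idm (tag y))))) /=.
by rewrite [free_fmap _ _]free_liftE /push /= mcomp1m.
Qed.

End FreeCover.

Section KernelFunctor.
Variables (C : category) (F G : ab_functor C) (t : nat_trans F G).

Definition ker_obj a : zmodType := subgroup (kerp (t a)).

Fact ker_fmap_subproof a b (f : mor a b) (x : ker_obj a) :
  fmap F f (val x) \in kerp (t b).
Proof.
case: x => x /= /eqP tx; apply/eqP.
by rewrite naturality tx raddf0.
Qed.

Definition ker_fmap a b (f : mor a b) (x : ker_obj a) : ker_obj b :=
  Subgroup (ker_fmap_subproof f x).

Fact ker_fmap_is_zmod_morphism a b (f : mor a b) : zmod_morphism (ker_fmap f).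
Proof. by move=> x y; apply: val_inj; rewrite /= !raddfB. Qed.

HB.instance Definition _ a b (f : mor a b) :=
  GRing.isZmodMorphism.Build (ker_obj a) (ker_obj b) (ker_fmap f)
    (ker_fmap_is_zmod_morphism f).

Fact ker_fmap1 a (x : ker_obj a) : ker_fmap (idm a) x = x.
Proof. by apply: val_inj; rewrite /= fmap1. Qed.

Fact ker_fmapM a b c (f : mor a b) (g : mor b c) (x : ker_obj a) :
  ker_fmap (mcomp f g) x = ker_fmap g (ker_fmap f x).
Proof. by apply: val_inj; rewrite /= fmapM. Qed.

Definition ker_functor : ab_functor C :=
  @AbFunctor C ker_obj (fun a b f => ker_fmap f) ker_fmap1 ker_fmapM.

Definition ker_incl : nat_trans ker_functor F :=
  @NatTrans C ker_functor F (fun a => val : {additive ker_obj a -> F a})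
    (fun a b f x => erefl).

Definition ker_cover : nat_trans (free_cover ker_functor) F :=
  ntrans_comp (free_cover_map ker_functor) ker_incl.

Lemma ker_cover_exact : exact_at ker_cover t.
Proof.
move=> a y; split=> [ty|[x <-]]; last first.
  by apply/eqP; exact: (valP (free_cover_map ker_functor a x)).
have ky : y \in kerp (t a) by apply/eqP.
have [x xE] := free_cover_surj (F := ker_functor) (Subgroup ky : ker_functor a).
by exists x; rewrite /= -/(free_cover_map ker_functor a x) xE.
Qed.

End KernelFunctor.

Section FreeResolution.
Variables (C : category) (F : ab_functor C).

Record res_stage := ResStage { src : ab_functor C; tgt : ab_functor C; arr : nat_trans src tgt }.

Fixpoint free_res_arrow n : res_stage :=
  if n is m.+1 then ResStage (ker_cover (arr (free_res_arrow m)))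
  else ResStage (free_cover_map F).

Definition free_resolution : projective_resolution F :=
  @ProjResolution C F (fun n => src (free_res_arrow n))
    (fun n => arr (free_res_arrow n.+1)) (arr (free_res_arrow 0))
    (fun n => match n with
              | 0%N => @free_cover_projective C F
              | m.+1 =>
                  @free_cover_projective C (ker_functor (arr (free_res_arrow m)))
              end)
    (free_cover_surj (F := F))
    (ker_cover_exact (arr (free_res_arrow 0)))
    (fun n => ker_cover_exact (arr (free_res_arrow n.+1))).

End FreeResolution.

(* The value at F of the n-th left derived functor of colim, computed on one
   projective resolution; left_derived_colimE below shows that any other one
   gives the same group up to isomorphism. *)
Definition left_derived_colim (C : category) (n : nat) (F : ab_functor C) : zmodType :=
  homology (colim_complex (free_resolution F)) n.

Section HomologyMap.
Variables (X Y : chain_complex) (f : forall n, {additive X n -> Y n}).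
Hypothesis f_diff : forall n x, f n (chain_diff X n x) = chain_diff Y n (f n.+1 x).
Variable n : nat.

Fact cycles_map_subproof (z : cycles X n) : f n (val z) \in is_cycle Y n.
Proof.
case: z => x /=; rewrite /is_cycle.
case: n x => [|m] x // /eqP dx; apply/eqP.
by rewrite -f_diff dx raddf0.
Qed.

Definition cycles_map (z : cycles X n) : cycles Y n :=
  Subgroup (cycles_map_subproof z).

Definition homology_map (x : homology X n) : homology Y n :=
  \pi_{ideal_quot boundaries Y n} (cycles_map (repr (x : {ideal_quot boundaries X n}))).

Lemma homology_mapE z :
  homology_map (\pi_{ideal_quot boundaries X n} z)
  = \pi_{ideal_quot boundaries Y n} (cycles_map z).
Proof.
rewrite /homology_map; case: piP => w /eqP.
rewrite -Quotient.idealrBE => /asboolP[y yE]; apply/eqP.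
rewrite eq_sym -Quotient.idealrBE; apply/asboolP; exists (f n.+1 y).
by rewrite -f_diff yE /= raddfB.
Qed.

Fact homology_map_is_zmod_morphism : zmod_morphism homology_map.
Proof.
move=> x y; rewrite -[x](@reprK _ {ideal_quot boundaries X n}).
rewrite -[y](@reprK _ {ideal_quot boundaries X n}).
rewrite -[_ - _](raddfB \pi_{ideal_quot boundaries X n}) !homology_mapE.
rewrite -[RHS](raddfB \pi_{ideal_quot boundaries Y n}); congr (\pi _).
by apply: val_inj; rewrite /= !raddfB.
Qed.

HB.instance Definition _ := GRing.isZmodMorphism.Build (homology X n)
  (homology Y n) homology_map homology_map_is_zmod_morphism.

End HomologyMap.

Lemma homology_map_can (X Y : chain_complex) (f : forall n, {additive X n -> Y n})
    (g : forall n, {additive Y n -> X n})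
    (f_diff : forall n x, f n (chain_diff X n x) = chain_diff Y n (f n.+1 x))
    (g_diff : forall n x, g n (chain_diff Y n x) = chain_diff X n (g n.+1 x)) n :
    (forall x, x \in is_cycle X n -> exists y, chain_diff X n y = g n (f n x) - x) ->
  cancel (homology_map f_diff (n := n)) (homology_map g_diff (n := n)).
Proof.
move=> gf x; rewrite -[x](@reprK _ {ideal_quot boundaries X n}) !homology_mapE.
apply/eqP; rewrite -Quotient.idealrBE; apply/asboolP.
by have [y yE] := gf _ (valP (repr (x : {ideal_quot boundaries X n}))); exists y; rewrite yE.
Qed.

Section NatTransOps.
Variables (C : category).
Implicit Types F G H : ab_functor C.

Definition ntrans_id F : nat_trans F F := @NatTrans C F F (fun a => idfun) (fun _ _ _ _ => erefl).

Fact ntrans_zero_natural F G a b (f : mor a b) (x : F a) :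
  (\0 : F b -> G b) (fmap F f x) = fmap G f (\0 x).
Proof. by rewrite /= raddf0. Qed.
Definition ntrans_zero F G : nat_trans F G :=
  @NatTrans C F G (fun a => \0) (@ntrans_zero_natural F G).

Fact ntrans_sub_natural F G (t u : nat_trans F G) a b (f : mor a b) (x : F a) :
  (t b \- u b) (fmap F f x) = fmap G f ((t a \- u a) x).
Proof. by rewrite /= !naturality raddfB. Qed.

Definition ntrans_sub F G (t u : nat_trans F G) : nat_trans F G :=
  @NatTrans C F G (fun a => t a \- u a) (@ntrans_sub_natural F G t u).

Lemma projective_lift F G H (P : ab_functor C) (u : nat_trans F G)
    (v : nat_trans G H) (t : nat_trans P G) :
  projective P -> exact_at u v -> (forall a x, v a (t a x) = 0) ->
  exists s : nat_trans P F, forall a x, u a (s a x) = t a x.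
Proof.
move=> Pproj uv vt.
have kP a (x : P a) : t a x \in kerp (v a) by apply/eqP/vt.
have kF a (x : F a) : u a x \in kerp (v a) by apply/eqP/uv; exists x.
have addP a : zmod_morphism (fun x => Subgroup (kP a x) : ker_obj v a).
  by move=> x y; apply: val_inj; rewrite /= !raddfB.
have addF a : zmod_morphism (fun x => Subgroup (kF a x) : ker_obj v a).
  by move=> x y; apply: val_inj; rewrite /= !raddfB.
pose hP a : {additive P a -> ker_obj v a} :=
  HB.pack (fun x => Subgroup (kP a x) : ker_obj v a)
    (GRing.isZmodMorphism.Build _ _ _ (addP a)).
pose hF a : {additive F a -> ker_obj v a} :=
  HB.pack (fun x => Subgroup (kF a x) : ker_obj v a)
    (GRing.isZmodMorphism.Build _ _ _ (addF a)).
have natP a b (f : mor a b) x : hP b (fmap P f x) = ker_fmap f (hP a x).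
  by apply: val_inj; rewrite /= naturality.
have natF a b (f : mor a b) x : hF b (fmap F f x) = ker_fmap f (hF a x).
  by apply: val_inj; rewrite /= naturality.
pose nP : nat_trans P (ker_functor v) := @NatTrans C P (ker_functor v) hP natP.
pose nF : nat_trans F (ker_functor v) := @NatTrans C F (ker_functor v) hF natF.
have nF_epi : pointwise_surj nF.
  move=> a [y yP]; have /eqP/uv[x xE] := yP.
  by exists x; apply: val_inj.
have [s sE] := Pproj _ _ nF nP nF_epi.
by exists s => a x; have /(congr1 val) := sE a x.
Qed.

Lemma colim_map_id F (x : colim F) : colim_map (ntrans_id F) x = x.
Proof. by apply: (colim_ext (h := idfun)) => a y; rewrite colim_mapE. Qed.

Lemma colim_map_comp F G H (t : nat_trans F G) (u : nat_trans G H) (x : colim F) :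
  colim_map (ntrans_comp t u) x = colim_map u (colim_map t x).
Proof.
apply: (colim_ext (h := colim_map u \o colim_map t)) => a y.
by rewrite [RHS]/= !colim_mapE.
Qed.

Lemma colim_map_sub F G (t u : nat_trans F G) (x : colim F) :
  colim_map (ntrans_sub t u) x = colim_map t x - colim_map u x.
Proof.
apply: (colim_ext (h := colim_map t \- colim_map u)) => a y.
by rewrite [RHS]/= !colim_mapE raddfB.
Qed.

Lemma colim_map_ext F G (t u : nat_trans F G) :
  (forall a x, t a x = u a x) -> colim_map t =1 colim_map u.
Proof. by move=> tu; apply: colim_ext => a y; rewrite !colim_mapE tu. Qed.

End NatTransOps.

Section Comparison.
Variables (C : category) (F : ab_functor C).
Implicit Types P Q : projective_resolution F.

Definition aug_res P n : ab_functor C := if n is m.+1 then res_obj P m else F.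

Definition aug_diff P n : nat_trans (aug_res P n.+1) (aug_res P n) :=
  match n with 0 => res_aug P | m.+1 => res_diff P m end.

Lemma aug_exact P n : exact_at (aug_diff P n.+1) (aug_diff P n).
Proof. by case: n => [|n]; [exact: res_exact0|exact: res_exact]. Qed.

Arguments aug_exact : clear implicits.

Lemma aug_diffK P n a x : aug_diff P n a (aug_diff P n.+1 a x) = 0.
Proof. by apply/aug_exact; exists x. Qed.

Section Lift.
Variables P Q : projective_resolution F.

Definition lift_spec n (f : nat_trans (aug_res P n) (aug_res Q n))
    (g : nat_trans (aug_res P n.+1) (aug_res Q n.+1)) :=
  forall a x, f a (aug_diff P n a x) = aug_diff Q n a (g a x).

Record partial_lift n := PartialLift {
  lift_lo : nat_trans (aug_res P n) (aug_res Q n);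
  lift_hi : nat_trans (aug_res P n.+1) (aug_res Q n.+1);
  _ : lift_spec lift_lo lift_hi
}.

Lemma lift_ex0 : exists g, @lift_spec 0 (ntrans_id F) g.
Proof.
have [g gE] := res_projective P 0 _ _ (res_aug Q) (res_aug P) (res_aug_surj Q).
by exists g => a x; rewrite /= gE.
Qed.

Lemma lift_exS n (l : partial_lift n) : exists g, lift_spec (lift_hi l) g.
Proof.
case: l => f g fg /=.
have [] := @projective_lift _ _ _ _ _ (aug_diff Q n.+1) (aug_diff Q n)
  (ntrans_comp (aug_diff P n.+1) g) (res_projective P n.+1) (aug_exact Q n).
  by move=> a x; rewrite /= -fg aug_diffK raddf0.
by move=> h hE; exists h => a x; rewrite hE.
Qed.

Fixpoint lift_seq n : partial_lift n :=
  if n is m.+1 then PartialLift (svalP (cid (lift_exS (lift_seq m))))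
  else PartialLift (svalP (cid lift_ex0)).

Definition lift_map n : nat_trans (res_obj P n) (res_obj Q n) := lift_lo (lift_seq n.+1).

Lemma lift_map_diff n a x :
  lift_map n a (res_diff P n a x) = res_diff Q n a (lift_map n.+1 a x).
Proof. by rewrite /lift_map; exact: (svalP (cid (lift_exS (lift_seq n)))). Qed.

Lemma lift_map_aug a x : res_aug Q a (lift_map 0 a x) = res_aug P a x.
Proof. by rewrite /lift_map -[LHS](svalP (cid lift_ex0)). Qed.

End Lift.

Section Homotopy.
Variables (P Q : projective_resolution F).
Variables (g : forall n, nat_trans (res_obj P n) (res_obj Q n)).
Hypothesis g_aug : forall a x, res_aug Q a (g 0 a x) = 0.
Hypothesis g_diff : forall n a x, g n a (res_diff P n a x) = res_diff Q n a (g n.+1 a x).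

Definition homotopy_spec n (h : nat_trans (res_obj P n) (res_obj Q n.+1))
    (h' : nat_trans (res_obj P n.+1) (res_obj Q n.+2)) :=
  forall a x, res_diff Q n.+1 a (h' a x) = g n.+1 a x - h a (res_diff P n a x).

Definition homotopy_inv n (h : nat_trans (res_obj P n) (res_obj Q n.+1)) :=
  forall a x, res_diff Q n a (h a (res_diff P n a x)) = res_diff Q n a (g n.+1 a x).

Lemma homotopy_ex0 : exists h : nat_trans (res_obj P 0) (res_obj Q 1),
  forall a x, res_diff Q 0 a (h a x) = g 0 a x.
Proof.
exact: (projective_lift (res_projective P 0) (res_exact0 Q) g_aug).
Qed.

Lemma homotopy_exS n h : @homotopy_inv n h -> exists h', homotopy_spec h h'.
Proof.
move=> hE; apply: (@projective_lift _ _ _ _ _ _ _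
  (ntrans_sub (g n.+1) (ntrans_comp (res_diff P n) h)) (res_projective P n.+1)
  (res_exact Q n)) => a x.
by rewrite /= raddfB hE subrr.
Qed.

Lemma homotopy_invS n h h' : @homotopy_spec n h h' -> homotopy_inv h'.
Proof.
move=> hh' a x; rewrite hh' g_diff (_ : res_diff P n a _ = 0) ?raddf0 ?subr0 ?addr0 //.
by apply/(res_exact P); exists x.
Qed.

Lemma homotopy_inv0 (h : nat_trans (res_obj P 0) (res_obj Q 1)) :
  (forall a x, res_diff Q 0 a (h a x) = g 0 a x) -> homotopy_inv h.
Proof. by move=> hE a x; rewrite hE g_diff. Qed.

Record partial_homotopy n := PartialHomotopy {
  homotopy_map : nat_trans (res_obj P n) (res_obj Q n.+1);
  homotopy_mapP : homotopy_inv homotopy_map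
}.

Fixpoint homotopy n : partial_homotopy n :=
  if n is m.+1 then
    PartialHomotopy (homotopy_invS (svalP (cid (homotopy_exS (homotopy_mapP (homotopy m))))))
  else PartialHomotopy (homotopy_inv0 (svalP (cid homotopy_ex0))).

Lemma homotopy0 a x : res_diff Q 0 a (homotopy_map (homotopy 0) a x) = g 0 a x.
Proof. exact: (svalP (cid homotopy_ex0)). Qed.

Lemma homotopyS n a x : res_diff Q n.+1 a (homotopy_map (homotopy n.+1) a x)
  = g n.+1 a x - homotopy_map (homotopy n) a (res_diff P n a x).
Proof. exact: (svalP (cid (homotopy_exS (homotopy_mapP (homotopy n))))). Qed.

Lemma colim_homotopy n (x : colim (res_obj P n)) : x \in is_cycle (colim_complex P) n ->
  exists y, chain_diff (colim_complex Q) n y = colim_map (g n) x.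
Proof.
move=> xc; exists (colim_map (homotopy_map (homotopy n)) x).
rewrite /= -colim_map_comp; case: n x xc => [|n] x /=.
  by move=> _; apply: colim_map_ext => a y; rewrite /= -[RHS]homotopy0.
move=> /eqP dx.
rewrite (@colim_map_ext _ _ _ _ (ntrans_sub (g n.+1)
  (ntrans_comp (res_diff P n) (homotopy_map (homotopy n))))).
  by rewrite colim_map_sub colim_map_comp [colim_map (res_diff P n) x]dx raddf0 subr0.
by move=> a y; rewrite /= -[RHS]homotopyS.
Qed.

End Homotopy.

Lemma colim_homology_iso P Q n :
  isomorphic (homology (colim_complex P) n) (homology (colim_complex Q) n).
Proof.
pose f (P Q : projective_resolution F) m :
  {additive colim_complex P m -> colim_complex Q m} := colim_map (lift_map P Q m).
have f_diff (P' Q' : projective_resolution F) m x :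
    f P' Q' m (chain_diff (colim_complex P') m x) = chain_diff (colim_complex Q') m (f P' Q' m.+1 x).
  rewrite /= -!colim_map_comp; apply: colim_map_ext => a y.
  exact: lift_map_diff.
have fK (P' Q' : projective_resolution F) m (x : colim_complex P' m) :
    x \in is_cycle (colim_complex P') m ->
  exists y, chain_diff (colim_complex P') m y = f Q' P' m (f P' Q' m x) - x.
  pose g k := ntrans_sub (ntrans_comp (lift_map P' Q' k) (lift_map Q' P' k))
                         (ntrans_id (res_obj P' k)).
  move=> /(@colim_homotopy P' P' g)[||y yE].
  - by move=> a y; rewrite /= raddfB !lift_map_aug subrr.
  - by move=> k a y; rewrite /= raddfB !lift_map_diff.
  by exists y; rewrite yE colim_map_sub colim_map_comp colim_map_id.
exists (homology_map (f_diff P Q) (n := n)).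
exists (homology_map (f_diff Q P) (n := n)); apply: homology_map_can; exact: fK.
Qed.

End Comparison.

Corollary left_derived_colimE (C : category) (F : ab_functor C)
    (P : projective_resolution F) (n : nat) :
  isomorphic (left_derived_colim n F) (homology (colim_complex P) n).
Proof. exact: colim_homology_iso. Qed.

Section TraceMonoid.
Variables (E : choiceType) (I : rel E).

Inductive trace_equiv : seq E -> seq E -> Prop :=
| TraceSwap u v a b : I a b -> trace_equiv (u ++ a :: b :: v) (u ++ b :: a :: v)
| TraceRefl u : trace_equiv u u
| TraceSym u v : trace_equiv u v -> trace_equiv v u
| TraceTrans u v w : trace_equiv u v -> trace_equiv v w -> trace_equiv u w.

Definition trace_rel : rel (seq E) := fun u v => `[< trace_equiv u v >].

Fact trace_rel_refl : reflexive trace_rel.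
Proof. by move=> u; apply/asboolP/TraceRefl. Qed.

Fact trace_rel_sym : symmetric trace_rel.
Proof. by move=> u v; apply/asboolP/asboolP => /TraceSym. Qed.

Fact trace_rel_trans : transitive trace_rel.
Proof.
by move=> v u w /asboolP uv /asboolP vw; apply/asboolP/(TraceTrans uv vw).
Qed.

Canonical trace_equiv_rel :=
  EquivRel trace_rel trace_rel_refl trace_rel_sym trace_rel_trans.

Definition trace_monoid := {eq_quot trace_rel}.
HB.instance Definition _ := Choice.on trace_monoid.

(* trace_of [:: a1; ...; an] is the product a1 ... an in M(E, I). *)
Definition trace_of (u : seq E) : trace_monoid := \pi_({eq_quot trace_rel}) u.

Lemma trace_ofP u v : reflect (trace_of u = trace_of v) (trace_rel u v).
Proof. by apply: (iffP idP) => /eqmodP. Qed.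

Lemma trace_of_surj (x : trace_monoid) : exists u, x = trace_of u.
Proof. by exists (repr (x : {eq_quot trace_rel})); rewrite /trace_of reprK. Qed.

Definition trace_one : trace_monoid := trace_of [::].

Definition trace_mul (x y : trace_monoid) : trace_monoid :=
  trace_of (repr (x : {eq_quot trace_rel}) ++ repr (y : {eq_quot trace_rel})).

Lemma trace_equiv_cat u u' v v' :
  trace_equiv u u' -> trace_equiv v v' -> trace_equiv (u ++ v) (u' ++ v').
Proof.
have catl w x y : trace_equiv x y -> trace_equiv (w ++ x) (w ++ y).
  elim=> [x1 x2 a b Iab|x1|x1 x2 _|x1 x2 x3 _ + _] {x y}.
  - by rewrite !catA; exact: TraceSwap.
  - exact: TraceRefl.
  - exact: TraceSym.
  - exact: TraceTrans.
have catr w x y : trace_equiv x y -> trace_equiv (x ++ w) (y ++ w).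
  elim=> [x1 x2 a b Iab|x1|x1 x2 _|x1 x2 x3 _ + _] {x y}.
  - by rewrite -!catA; exact: TraceSwap.
  - exact: TraceRefl.
  - exact: TraceSym.
  - exact: TraceTrans.
by move=> uu' vv'; exact: TraceTrans (catr _ _ _ uu') (catl _ _ _ vv').
Qed.

Lemma trace_of_cat u v : trace_of (u ++ v) = trace_mul (trace_of u) (trace_of v).
Proof.
apply/trace_ofP/asboolP/trace_equiv_cat; apply/asboolP/trace_ofP;
  by rewrite /trace_of reprK.
Qed.

Fact trace_mulA : associative trace_mul.
Proof.
move=> x y z; have [u ->] := trace_of_surj x; have [v ->] := trace_of_surj y.
by have [w ->] := trace_of_surj z; rewrite -!trace_of_cat catA.
Qed.

Fact trace_mul1 : left_id trace_one trace_mul.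
Proof. by move=> x; have [u ->] := trace_of_surj x; rewrite -trace_of_cat. Qed.

Fact trace_mulr1 : right_id trace_one trace_mul.
Proof.
by move=> x; have [u ->] := trace_of_surj x; rewrite -trace_of_cat cats0.
Qed.

HB.instance Definition _ :=
  isMonoid.Build trace_monoid trace_mulA trace_mul1 trace_mulr1.

End TraceMonoid.

(* pact s w = None means that s . w is undefined. *)
Record partial_action (M : monoidType) (S : Type) := PartialAction {
  pact :> S -> M -> option S;
  pact1 : forall s, pact s 1%g = Some s;
  pactM : forall s v w, pact s (v * w)%g = obind (pact^~ w) (pact s v)
}.

Definition state_space (E : choiceType) (I : rel E) (S : Type) :=
  partial_action (trace_monoid I) S.

Section StateCategory.
Variables (M : monoidType) (S : choiceType) (X : partial_action M S).

Definition state_hom (s s' : S) : Type := {w : M | X s w == Some s'}.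

Definition state_id s : state_hom s s :=
  exist (fun w => X s w == Some s) 1%g (introT eqP (pact1 X s)).

Fact state_comp_subproof s s' s'' (v : state_hom s s') (w : state_hom s' s'') :
  X s (sval v * sval w)%g == Some s''.
Proof. by rewrite pactM (eqP (svalP v)) /= (svalP w). Qed.

Definition state_comp s s' s'' (v : state_hom s s') (w : state_hom s' s'') :
  state_hom s s'' :=
  exist (fun u => X s u == Some s'') (sval v * sval w)%g (state_comp_subproof v w).

Fact state_comp1m s s' (v : state_hom s s') : state_comp (state_id s) v = v.
Proof. by apply: val_inj; rewrite /= mul1g. Qed.

Fact state_compm1 s s' (v : state_hom s s') : state_comp v (state_id s') = v.
Proof. by apply: val_inj; rewrite /= mulg1. Qed.

Fact state_compA s1 s2 s3 s4 (u : state_hom s1 s2) (v : state_hom s2 s3)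
    (w : state_hom s3 s4) :
  state_comp u (state_comp v w) = state_comp (state_comp u v) w.
Proof. by apply: val_inj; rewrite /= mulgA. Qed.

Definition state_category : category :=
  Category state_comp1m state_compm1 state_compA.

End StateCategory.

Section AlternatingSum.
Variables (A : zmodType) (n : nat) (f : 'I_n.+2 -> 'I_n.+1 -> A).

Lemma alternating_sum0 :
    (forall (k : 'I_n.+2) (j : 'I_n.+1) (k' : 'I_n.+1) (j' : 'I_n.+2),
      (j < k)%N -> k = k'.+1 :> nat -> j = j' :> nat -> f k j = f j' k') ->
  \sum_(k < n.+2) \sum_(j < n.+1) f k j *~ (-1) ^+ (k + j) = 0.
Proof.
move=> fE; rewrite pair_big /= (bigID (fun p : 'I_n.+2 * 'I_n.+1 => p.2 < p.1)%N) /=.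
pose h (p : 'I_n.+2 * 'I_n.+1) : 'I_n.+2 * 'I_n.+1 := (inord p.2.+1, inord p.1).
pose h' (p : 'I_n.+2 * 'I_n.+1) : 'I_n.+2 * 'I_n.+1 := (inord p.2, inord p.1.-1).
rewrite (reindex_onto h h') /=; last first.
  case=> k j /= jk; rewrite /h /h' /=.
  have kn := ltn_ord k; have jn := ltn_ord j.
  rewrite inordK; last by rewrite -ltnS prednK //; exact: leq_ltn_trans jk.
  rewrite inordK; last exact: ltnW.
  rewrite prednK; last exact: leq_ltn_trans jk.
  by rewrite !inord_val.
rewrite (eq_bigl (fun p : 'I_n.+2 * 'I_n.+1 => ~~ (p.2 < p.1)%N)); last first.
  case=> k j; have kn := ltn_ord k; have jn := ltn_ord j.
  rewrite /h /h' /= -leqNgt [inord j.+1 : nat]inordK ?ltnS //=.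
  have [kj|jk] := leqP k j.
    by rewrite inordK ?(leq_ltn_trans kj) // kj !inord_val eqxx.
  apply/negbTE/negP => /andP[+ /eqP[kE _]].
  have kn' : (k < n.+1)%N.
    by rewrite -kE inordK //; exact: leq_trans (ltn_ord _) _.
  by rewrite inordK // leqNgt jk.
rewrite -big_split /= big1 // => -[k j] /=; rewrite -leqNgt => kj.
have jn := ltn_ord j; have kn : (k < n.+1)%N by exact: leq_ltn_trans kj jn.
rewrite (fE _ _ j k) ?inordK ?ltnS //.
by rewrite addSn exprS mulN1r mulrNz [(j + k)%N]addnC addNr.
Qed.

End AlternatingSum.

Section Cubes.
Variables (disp : Order.disp_t) (E : orderType disp) (I : rel E).
Variables (S : choiceType) (X : state_space I S).

(* pairwise r t says that r (tnth t i) (tnth t j) for all i < j. *)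
Definition is_Qbar n (x : S * n.-tuple E) : bool :=
  pairwise (fun a b => (a < b)%O && I a b) x.2 && isSome (X x.1 (trace_of I x.2)).

Definition Qbar n := {x : S * n.-tuple E | is_Qbar x}.
HB.instance Definition _ n := Choice.on (Qbar n).

Definition del_letter n (i : 'I_n.+1) (t : n.+1.-tuple E) : n.-tuple E :=
  [tuple tnth t (fintype.lift i j) | j < n].

(* Junk value s where s . a is undefined; see stepE for its use in face1. *)
Definition step s a : S := odflt s (X s (trace_of I [:: a])).

Lemma val_del_letter n (i : 'I_n.+1) (t : n.+1.-tuple E) :
  del_letter i t = take i t ++ drop i.+1 t :> seq E.
Proof.
have a0 := tnth t ord0; have im := ltn_ord i.
apply: (@eq_from_nth _ a0) => [|j].
  by rewrite size_tuple size_cat size_take size_drop size_tuple ltn_ord subSS subnKC.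
rewrite size_tuple => jn; rewrite -(tnth_nth a0 _ (Ordinal jn)) tnth_mktuple.
rewrite (tnth_nth a0) /= /bump nth_cat size_take size_tuple ltn_ord.
by have [ij|ji] := leqP i j; rewrite ?nth_take // nth_drop addSn subnKC.
Qed.

Lemma tuple_split n (i : 'I_n.+1) (t : n.+1.-tuple E) :
  t = take i t ++ tnth t i :: drop i.+1 t :> seq E.
Proof.
by rewrite (tnth_nth (tnth t i)) -drop_nth ?cat_take_drop ?size_tuple.
Qed.

Lemma trace_commute a (w : seq E) : all (fun b => I a b || I b a) w ->
  trace_of I (w ++ [:: a]) = trace_of I (a :: w).
Proof.
elim: w => [//|b w IH] /= /andP[Iab /IH] /trace_ofP/asboolP wE.
apply/trace_ofP/asboolP; apply: (TraceTrans (v := [:: b] ++ a :: w)).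
  by rewrite -[b :: _]/([:: b] ++ _); apply: trace_equiv_cat => //; exact: TraceRefl.
by case/orP: Iab => Iab; [apply: TraceSym|]; exact: (TraceSwap [::]).
Qed.

Lemma pairwise_del_letter n (i : 'I_n.+1) (t : n.+1.-tuple E) r :
  pairwise r t -> pairwise r (del_letter i t).
Proof.
by rewrite val_del_letter {1}(tuple_split i t) !pairwise_cat allrel_consr /=
  => /and3P[/andP[_ ->] -> /andP[_ ->]].
Qed.

Section Face.
Variables (n : nat) (s : S) (t : n.+1.-tuple E).
Hypothesis st : is_Qbar (s, t).
Variable i : 'I_n.+1.

Let inI : all (fun b => I (tnth t i) b || I b (tnth t i)) (take i t) /\
  all (fun b => I (tnth t i) b || I b (tnth t i)) (drop i.+1 t).
Proof.
have /andP[] := st; rewrite /= {1}(tuple_split i t) pairwise_cat allrel_consr /=.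
case/and3P=> /andP[/allP ua _] _ /andP[/allP aw _] _.
split; apply/allP => b; first by move/ua => /andP[_ ->]; rewrite orbT.
by move/aw => /andP[_ ->].
Qed.

Lemma trace_del_letterl :
  trace_of I t = (trace_of I [:: tnth t i] * trace_of I (del_letter i t))%g.
Proof.
rewrite {1}(tuple_split i t) val_del_letter -cat1s catA trace_of_cat trace_commute ?inI.1 //.
by rewrite -cat1s !trace_of_cat -trace_mulA.
Qed.

Lemma trace_del_letterr :
  trace_of I t = (trace_of I (del_letter i t) * trace_of I [:: tnth t i])%g.
Proof.
rewrite {1}(tuple_split i t) val_del_letter trace_of_cat -(trace_commute inI.2).
by rewrite !trace_of_cat trace_mulA.
Qed.

Lemma stepE : X s (trace_of I [:: tnth t i]) = Some (step s (tnth t i)).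
Proof.
have /andP[_] := st; rewrite /= trace_del_letterl pactM /step.
by case: (X s (trace_of I [:: tnth t i])).
Qed.

Fact face1_subproof : is_Qbar (step s (tnth t i), del_letter i t).
Proof.
have /andP[/= pt] := st; rewrite trace_del_letterl pactM stepE /= => sd.
by rewrite /is_Qbar /= pairwise_del_letter.
Qed.

Fact face0_subproof : is_Qbar (s, del_letter i t).
Proof.
have /andP[/= pt] := st; rewrite trace_del_letterr pactM => sd.
by rewrite /is_Qbar /= pairwise_del_letter //; case: (X s _) sd.
Qed.

End Face.

Definition mkQbar n s (t : n.-tuple E) (st : is_Qbar (s, t)) : Qbar n :=
  exist (fun x : S * n.-tuple E => is_Qbar x) (s, t) st.

(* face1 i and face0 i send (s, a) to (s . a_i, a without a_i) and
   (s, a without a_i); positions are counted from 0. *)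
Definition face1 n (i : 'I_n.+1) (q : Qbar n.+1) : Qbar n :=
  let: exist (s, t) st := q in mkQbar (face1_subproof st i).

Definition face0 n (i : 'I_n.+1) (q : Qbar n.+1) : Qbar n :=
  let: exist (s, t) st := q in mkQbar (face0_subproof st i).

(* The exponent is i.+1 because the i-th letter here is a_(i+1) in the usual
   numbering from 1. *)
Definition Qbar_diff_gen n (q : Qbar n.+1) : {freeg (Qbar n)} :=
  \sum_(i < n.+1) free_gen (face1 i q) *~ (-1) ^+ i.+1
  - \sum_(i < n.+1) free_gen (face0 i q) *~ (-1) ^+ i.+1.

Definition Qbar_diff n : {additive {freeg (Qbar n.+1)} -> {freeg (Qbar n)}} :=
  free_lift (@Qbar_diff_gen n).

Section FaceFace.
Variables (n : nat) (k k' : 'I_n.+1) (j j' : 'I_n.+2).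
Hypotheses (kj : (k < j)%N) (jk : j = k'.+1 :> nat) (kk : k = j' :> nat).

Lemma del_letterC (t : n.+2.-tuple E) : del_letter k (del_letter j t) = del_letter k' (del_letter j' t).
Proof.
apply: eq_from_tnth => m; rewrite !tnth_mktuple; congr tnth.
by apply: val_inj; rewrite /= /bump; lia.
Qed.

Lemma tnth_del_letter (t : n.+2.-tuple E) :
  (tnth (del_letter j t) k = tnth t j') * (tnth (del_letter j' t) k' = tnth t j).
Proof.
by split; rewrite tnth_mktuple; congr tnth; apply: val_inj; rewrite /= /bump; lia.
Qed.

Lemma face_face (q : Qbar n.+2) :
  [/\ face1 k (face1 j q) = face1 k' (face1 j' q),
      face1 k (face0 j q) = face0 k' (face1 j' q),
      face0 k (face1 j q) = face1 k' (face0 j' q)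
    & face0 k (face0 j q) = face0 k' (face0 j' q)].
Proof.
case: q => -[s t] st /=; split; apply: val_inj => /=;
  rewrite ?tnth_del_letter del_letterC //; congr pair.
have sj := stepE (face1_subproof st j) k; have sj' := stepE (face1_subproof st j') k'.
rewrite !tnth_del_letter in sj sj'.
have x0 : E := tnth t j.
have /andP[/= /(pairwiseP x0) pt _] := st.
have /andP[_ Ijj] : (tnth t j' < tnth t j)%O && I (tnth t j') (tnth t j).
  rewrite !(tnth_nth x0); apply: pt; rewrite ?inE ?size_tuple //.
  by rewrite -kk.
have : trace_of I ([:: tnth t j] ++ [:: tnth t j'])
     = trace_of I ([:: tnth t j'] ++ [:: tnth t j]).
  by rewrite [LHS]trace_commute //= Ijj ?orbT.
rewrite !trace_of_cat => /(congr1 (X s)).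
by rewrite !(@pactM (trace_monoid I)) !(stepE st) /= sj sj' => -[].
Qed.

End FaceFace.

Lemma Qbar_diffE n (q : Qbar n.+1) : Qbar_diff n (free_gen q) =
  - \sum_(k < n.+1) (free_gen (face1 k q) - free_gen (face0 k q)) *~ (-1) ^+ k.
Proof.
rewrite [LHS]free_liftE /Qbar_diff_gen -sumrB -sumrN; apply: eq_bigr => k _.
by rewrite exprS mulN1r !mulrNz mulrzBl opprB opprK addrC.
Qed.

Fact Qbar_diffK n (x : {freeg (Qbar n.+2)}) : Qbar_diff n (Qbar_diff n.+1 x) = 0.
Proof.
apply: (free_ext (g := Qbar_diff n \o Qbar_diff n.+1) (h := \0)) => q /=.
rewrite Qbar_diffE raddfN raddf_sum /=; apply/eqP; rewrite oppr_eq0; apply/eqP.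
rewrite -[RHS]oppr0 -[X in _ = - X](@alternating_sum0 _ n (fun k j =>
    free_gen (face1 j (face1 k q)) - free_gen (face0 j (face1 k q))
    - (free_gen (face1 j (face0 k q)) - free_gen (face0 j (face0 k q))))); last first.
  move=> j k k' j' kj jk kk; have [-> -> -> ->] := face_face kj jk kk q.
  by rewrite !opprD !opprK !addrA; congr (_ + _); exact: addrAC.
rewrite -sumrN; apply: eq_bigr => k _.
rewrite raddfMz raddfB /= !Qbar_diffE opprK addrC -opprB mulNrz; congr (- _).
rewrite -sumrB mulrz_suml; apply: eq_bigr => j _.
by rewrite -mulrzBl -mulrzA exprD mulrC.
Qed.

(* In degree 0, Qbar 0 consists of the pairs (s, empty tuple), since s . 1 is
   always defined. *)
Definition Qbar_complex : chain_complex :=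
  ChainComplex (fun n => Qbar_diffK (n := n)).

End Cubes.

(* Main.v *)
Require Import Defs.
From HB Require Import structures.
From mathcomp Require Import all_boot all_order all_algebra.
From mathcomp Require Import boolp zify.
From mathcomp.multinomials Require Import freeg.

(** The homology of the state category is computed from a projective resolution
of the constant functor by free functors, one free generator for each cube
(s, a_1, ..., a_n).  The generator of a cube q is placed at its top state
s . (a_1 ... a_n), so the value of the n-th functor at a state b is free on the
cells (s, a_1, ..., a_n; w) with s . (a_1 ... a_n w) = b.  In the boundary of a
cell, one face along a_k replaces s by s . a_k and keeps w, the other one keeps
s and replaces w by a_k w.  The colimit of a free functor is the free group on
its generators (colim_free_on), and this turns the boundary of cells into that
of cubes (colim_cell_diff).  What remains is the exactness at every state b.

The total trace u = a_1 ... a_n w is unchanged by the face that keeps s, and is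
shortened by one letter by the face that moves s.  So, up to shorter traces, the
complex splits over the pairs (s, u), and the summand of (s, u) is spanned by
the sets of pairwise commuting letters a_1, ..., a_n such that u is divisible by
a_1 ... a_n on the left.  Left divisors of u that are letters commute pairwise
and their product divides u, so this is the augmented chain complex of a full
simplex, which is contractible when u <> 1.  The contraction inserts the least
letter m dividing u; it comes first in the tuple, whence no signs.  In matching
form: a cell whose first letter is m is paired with its face that keeps s and
omits m.

The precubical part shows abstractly that such a matching, together with a
weight preserved by one family of faces and decreased by the other, makes the
complex exact except for at most one class in degree 0 (bdry_exact,
bdry_exact0). The combinatorial input on traces is that letters can be cancelled
on the left (letter_cancel), and that a letter outside a clique which divides
the product of the clique and w commutes with the clique and divides w
(leads_cat). Both hold because the commutations change neither whether the first
occurrence of a letter can be moved to the front of a word (lead_word_equiv) nor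
the trace of the word from which it is erased (rem_equiv). *)

Set Implicit Arguments.
Unset Strict Implicit.
Unset Printing Implicit Defensive.

Import Order.TTheory GRing.Theory.
Local Open Scope ring_scope.
Local Open Scope quotient_scope.

(** * Leading letters of a trace *)

Section LeadingLetters.
Variables (E : choiceType) (I : rel E).
Hypothesis I_sym : symmetric I.
Implicit Types (m : E) (u v : seq E) (x y : trace_monoid I).

(** The first occurrence of m in u can be moved to the front by commutations:
this decides on words whether m divides the trace of u on the left. *)
Fixpoint lead_word m u : bool :=
  if u is c :: u' then (c == m) || I m c && lead_word m u' else false.

Lemma lead_word_swap m u v a b : I a b ->
  lead_word m (u ++ a :: b :: v) = lead_word m (u ++ b :: a :: v).
Proof.
move=> Iab; elim: u => [|c u /= -> //] /=.
have [<-|am] := eqVneq a m; first by rewrite Iab andbT orbT.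
by have [bm|_] := eqVneq b m; rewrite //= -?bm 1?I_sym ?Iab // andbCA.
Qed.

(** A swap either avoids the first occurrence of m, and survives its erasure,
or involves it, and then both words become equal. *)
Lemma rem_swap m u v a b : I a b ->
  trace_equiv I (rem m (u ++ a :: b :: v)) (rem m (u ++ b :: a :: v)).
Proof.
move=> Iab; elim: u => [|c u IH] /=.
  have [am|_] := eqVneq a m; have [bm|_] := eqVneq b m.
  - by rewrite am bm; exact: TraceRefl.
  - exact: TraceRefl.
  - exact: TraceRefl.
  - exact: (TraceSwap [::]).
have [_|_] := eqVneq c m; first exact: TraceSwap.
by rewrite -(cat1s c (rem _ (_ ++ a :: _))) -(cat1s c (rem _ _));
  apply: trace_equiv_cat IH; exact: TraceRefl.
Qed.

Lemma lead_word_equiv m u v : trace_equiv I u v -> lead_word m u = lead_word m v.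
Proof.
by elim=> {u v} [u v a b /lead_word_swap|//|u v _ ->|u v w _ -> _ ->].
Qed.

Lemma rem_equiv m u v : trace_equiv I u v -> trace_equiv I (rem m u) (rem m v).
Proof.
elim=> {u v} [u v a b /rem_swap|u|u v _ /TraceSym|u v w _ uv _] //.
  exact: TraceRefl.
exact: TraceTrans.
Qed.

Lemma size_equiv u v : trace_equiv I u v -> size u = size v.
Proof.
by elim=> {u v} [u v a b _|//|u v _ ->|u v w _ -> _ ->] //; rewrite !size_cat.
Qed.

(** A word representing x, chosen once and for all; the functions on traces below
are computed on it and do not depend on the choice. *)
Definition word_of x : seq E := repr (x : {eq_quot trace_rel I}).

Lemma word_ofK x : trace_of I (word_of x) = x.
Proof. exact: reprK. Qed.

Lemma word_of_equiv u : trace_equiv I (word_of (trace_of I u)) u.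
Proof. by apply/asboolP/trace_ofP; rewrite word_ofK. Qed.

Definition letter m : trace_monoid I := trace_of I [:: m].
Definition leads m x : bool := lead_word m (word_of x).
Definition strip m x : trace_monoid I := trace_of I (rem m (word_of x)).
Definition trace_size x : nat := size (word_of x).

Lemma leads_trace_of m u : leads m (trace_of I u) = lead_word m u.
Proof. exact/lead_word_equiv/word_of_equiv. Qed.

Lemma strip_trace_of m u : strip m (trace_of I u) = trace_of I (rem m u).
Proof. exact/trace_ofP/asboolP/rem_equiv/word_of_equiv. Qed.

Lemma trace_size_of u : trace_size (trace_of I u) = size u.
Proof. exact/size_equiv/word_of_equiv. Qed.

Lemma trace_ofM u v : trace_of I (u ++ v) = (trace_of I u * trace_of I v)%g.
Proof. exact: trace_of_cat. Qed.

Lemma trace_of_cons a u : trace_of I (a :: u) = (letter a * trace_of I u)%g.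
Proof. exact: (trace_ofM [:: a]). Qed.

Lemma letterM a x : (letter a * x)%g = trace_of I (a :: word_of x).
Proof. by rewrite trace_of_cons word_ofK. Qed.

Lemma leads_letterM m x : leads m (letter m * x)%g.
Proof. by rewrite letterM leads_trace_of /= eqxx. Qed.

Lemma stripK m x : strip m (letter m * x)%g = x.
Proof. by rewrite letterM strip_trace_of /= eqxx word_ofK. Qed.

Lemma letter_cancel m x y : (letter m * x)%g = (letter m * y)%g -> x = y.
Proof. by move/(congr1 (strip m)); rewrite !stripK. Qed.

Lemma trace_size_letterM m x : trace_size (letter m * x)%g = (trace_size x).+1.
Proof. by rewrite letterM trace_size_of. Qed.

Lemma trace_size_eq0 x : trace_size x = 0 -> x = 1%g.
Proof. by move=> /size0nil x0; rewrite -[x]word_ofK x0. Qed.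

Lemma letterC a b : I a b -> (letter a * letter b)%g = (letter b * letter a)%g.
Proof.
by move=> Iab; rewrite /letter -!trace_ofM; apply/trace_ofP/asboolP/(TraceSwap [::]).
Qed.

Lemma leads_strip m x : leads m x -> x = (letter m * strip m x)%g.
Proof.
rewrite -[x in RHS]word_ofK -{2}[x]word_ofK strip_trace_of /leads.
elim: (word_of x) => //= c u IH.
have [->|_ /= /andP[Imc /IH uE]] := eqVneq c m; first by rewrite trace_of_cons.
by rewrite !trace_of_cons uE !mulgA (letterC Imc).
Qed.

(** On the word u followed by a word for x, the first occurrence of m lies in
the second part, so it has to cross all of u to reach the front. *)
Lemma leads_cat m u x : m \notin u -> leads m (trace_of I u * x)%g ->
  all (I m) u /\ leads m x.
Proof.
rewrite -{1}[x]word_ofK -trace_ofM leads_trace_of /leads.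
elim: u => //= c u IH; rewrite inE negb_or eq_sym => /andP[/negbTE-> mu] /=.
by case/andP=> -> /IH[].
Qed.

Lemma letter_commute m u : all (I m) u ->
  (trace_of I u * letter m)%g = (letter m * trace_of I u)%g.
Proof.
elim: u => [|c u IH] /=.
  by rewrite -/(trace_one I) [LHS]trace_mul1 [RHS]trace_mulr1.
by case/andP=> Imc /IH uE; rewrite trace_of_cons -mulgA uE !mulgA (letterC Imc).
Qed.

End LeadingLetters.

Section LeastLetter.
Variables (disp : Order.disp_t) (E : orderType disp) (I : rel E).

Definition least_lead (m : E) (x : trace_monoid I) : Prop :=
  leads m x /\ forall m', leads m' x -> (m <= m')%O.

Lemma least_lead_uniq m m' x : least_lead m x -> least_lead m' x -> m = m'.
Proof. by move=> [mx mE] [mx' mE']; apply/le_anti; rewrite mE ?mE'. Qed.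

Lemma lead_word_in (m : E) u : lead_word I m u -> m \in u.
Proof.
by elim: u => //= c u IH /orP[/eqP->|/andP[_ /IH mu]]; rewrite inE ?eqxx ?mu ?orbT.
Qed.

(** Leading letters of x occur in every word for x, so there are finitely many
of them, and the first letter of a word is one. *)
Lemma least_lead_ex x : trace_size x != 0%N -> exists m, least_lead m x.
Proof.
rewrite /least_lead /leads /trace_size => x0.
have [c cx] : exists c, lead_word I c (word_of x).
  by case: (word_of x) x0 => // c u _; exists c; rewrite /= eqxx.
have := sort_le_sorted [seq a <- word_of x | lead_word I a (word_of x)].
have sE a : (a \in sort <=%O [seq b <- word_of x | lead_word I b (word_of x)])
    = lead_word I a (word_of x).
  by rewrite mem_sort mem_filter andb_idr //; exact: lead_word_in.
case: (sort _ _) sE => [|m s] sE; first by have := sE c; rewrite cx.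
move=> ms; exists m; rewrite -sE mem_head; split=> // a; rewrite -sE inE.
case/predU1P=> [->//|]; apply/allP.
by rewrite /= (path_sortedE le_trans) in ms; case/andP: ms.
Qed.
End LeastLetter.

(** * Precubical sets with a collapsing scheme *)

Section Precubical.
Variables (B : nat -> choiceType) (f0 f1 : forall n, 'I_n.+1 -> B n.+1 -> B n).
Hypothesis precubical : forall n (k k' : 'I_n.+1) (j j' : 'I_n.+2) (e : B n.+2),
  (k < j)%N -> j = k'.+1 :> nat -> k = j' :> nat ->
  [/\ f1 k (f1 j e) = f1 k' (f1 j' e), f1 k (f0 j e) = f0 k' (f1 j' e),
      f0 k (f1 j e) = f1 k' (f0 j' e) & f0 k (f0 j e) = f0 k' (f0 j' e)].

Definition face_sum (f : forall n, 'I_n.+1 -> B n.+1 -> B n) n :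
    {additive {freeg (B n.+1)} -> {freeg (B n)}} :=
  free_lift (fun e => \sum_(k < n.+1) free_gen (f n k e) *~ (-1) ^+ k).

Lemma face_sumE f n (e : B n.+1) :
  face_sum f n (free_gen e) = \sum_(k < n.+1) free_gen (f n k e) *~ (-1) ^+ k.
Proof. exact: free_liftE. Qed.

(** The sign of the k-th term is + for f0, so that f0 ord0, the face used in the
matching below, has coefficient 1. *)
Definition bdry n : {additive {freeg (B n.+1)} -> {freeg (B n)}} :=
  face_sum f0 n \- face_sum f1 n.

Lemma bdryE n (e : B n.+1) : bdry n (free_gen e) =
  \sum_(k < n.+1) (free_gen (f0 k e) - free_gen (f1 k e)) *~ (-1) ^+ k.
Proof.
by rewrite /= !face_sumE -sumrB; apply: eq_bigr => k _; rewrite mulrzBl.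
Qed.

Lemma bdryK n (x : {freeg (B n.+2)}) : bdry n (bdry n.+1 x) = 0.
Proof.
apply: (free_ext (g := bdry n \o bdry n.+1) (h := \0)) => e.
change (bdry n (bdry n.+1 (free_gen e)) = 0); rewrite bdryE raddf_sum.
rewrite -[RHS](@alternating_sum0 _ n (fun k j =>
    free_gen (f0 j (f0 k e)) - free_gen (f1 j (f0 k e))
    - (free_gen (f0 j (f1 k e)) - free_gen (f1 j (f1 k e))))); last first.
  move=> j k k' j' kj jk kk; have [-> -> -> ->] := precubical e kj jk kk.
  by rewrite !opprB addrACA [RHS]addrACA; congr (_ + _); rewrite addrC.
apply: eq_bigr => k _; rewrite raddfMz raddfB !bdryE -sumrB mulrz_suml.
apply: eq_bigr => j _.
by rewrite -mulrzBl -mulrzA exprD mulrC.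
Qed.

Definition aug : {additive {freeg (B 0)} -> int} := free_lift (fun=> 1 : int).

Lemma aug_bdry x : aug (bdry 0 x) = 0.
Proof.
apply: (free_ext (g := aug \o bdry 0) (h := \0)) => e.
change (aug (bdry 0 (free_gen e)) = 0).
by rewrite bdryE big_ord1 raddfMz raddfB /= !free_liftE subrr mul0rz.
Qed.

(** A matching pairs each cell e satisfying [up] with its face f0 ord0 e; the
partner satisfies [collapses].  The faces f0 preserve the weight and the faces
f1 decrease it, so the latter are perturbations.  [up_f0] says that a matched
pair is stable under the faces other than the one that relates its members.  A
cell that belongs to no pair has degree and weight 0, and there is at most one. *)
Variables (wt : forall n, B n -> nat) (up : forall n, B n.+1 -> Prop).
Arguments wt {n}.
Arguments up {n}.

Definition collapses n (e : B n) : Prop := exists2 e' : B n.+1, up e' & f0 ord0 e' = e.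

Hypothesis wt_f0 : forall n (k : 'I_n.+1) e, wt (f0 k e) = wt e.
Hypothesis wt_f1 : forall n (k : 'I_n.+1) e, (wt (f1 k e) < wt e)%N.
Hypothesis up_f0 : forall n (k : 'I_n.+1) (e : B n.+2),
  up e -> up (f0 (fintype.lift ord0 k) e).
Hypothesis up_inj : forall n (e e' : B n.+1),
  up e -> up e' -> f0 ord0 e = f0 ord0 e' -> e = e'.
Hypothesis up_not_collapses : forall n (e : B n.+1), up e -> ~ collapses e.
Hypothesis up_or_collapses : forall n (e : B n.+1), up e \/ collapses e.
Hypothesis collapses0 : forall e : B 0, wt e != 0%N -> collapses e.
Hypothesis base_uniq : forall e e' : B 0, wt e = 0%N -> wt e' = 0%N -> e = e'.

(** The weight filtration, along which exactness is proved by induction. *)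
Definition span n L : {pred {freeg (B n)}} :=
  generated (fun x => exists2 e : B n, (wt e < L)%N & x = free_gen e).
Arguments span : clear implicits.
HB.instance Definition _ n L := GRing.ZmodClosed.on (span n L).

Lemma span_gen n L (e : B n) : (wt e < L)%N -> free_gen e \in span n L.
Proof. by move=> eL; apply/asboolP/GeneratedIn; exists e. Qed.

Lemma span_sub n L (A : zmodType) (f : {additive {freeg (B n)} -> A})
    (P : zmodClosed A) :
  (forall e : B n, (wt e < L)%N -> f (free_gen e) \in P) ->
  forall x, x \in span n L -> f x \in P.
Proof.
move=> fP x /asboolP; elim=> {x} [_ [e eL ->]||x y _ xP _ yP]; first exact: fP.
  by rewrite raddf0 rpred0.
by rewrite raddfB rpredB.
Qed.

Lemma span_le n L L' x : (L <= L')%N -> x \in span n L -> x \in span n L'.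
Proof.
move=> LL'; apply: (span_sub (f := idfun)) => e eL.
exact/span_gen/(leq_trans eL).
Qed.

Lemma span_ex n (x : {freeg (B n)}) : exists L, x \in span n L.
Proof.
elim/freeg_ind_dom0: x => [|m e D _ _ [L DL]]; first by exists 0%N; rewrite rpred0.
exists (maxn L (wt e).+1).
have -> : << m *g e >> = free_gen e *~ m by rewrite freegU_mulz intz.
by rewrite rpredD ?rpredMz ?span_gen ?leq_maxr // (span_le _ DL) ?leq_maxl.
Qed.

(** The contracting homotopy.  The partner of a cell is obtained by choice, but
it is unique by [up_inj]. *)
Definition hpty_gen n (e : B n) : {freeg (B n.+1)} :=
  if pselect (collapses e) is left p then free_gen (s2val (cid2 p)) else 0.

Definition hpty n : {additive {freeg (B n)} -> {freeg (B n.+1)}} :=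
  free_lift (@hpty_gen n).

Lemma hpty_collapse n (e : B n.+1) :
  up e -> hpty n (free_gen (f0 ord0 e)) = free_gen e.
Proof.
move=> ue; rewrite [LHS]free_liftE /hpty_gen; case: pselect => [p|[]]; last by exists e.
by case: cid2 => e' ue' /= e'E; rewrite (up_inj ue' ue e'E).
Qed.

Lemma hpty_up n (e : B n.+1) : up e -> hpty n.+1 (free_gen e) = 0.
Proof.
move=> ue; rewrite [LHS]free_liftE /hpty_gen; case: pselect => [p|//].
by have := up_not_collapses ue p.
Qed.

Lemma hpty_span n L x : x \in span n L -> hpty n x \in span n.+1 L.
Proof.
apply: span_sub => e eL; rewrite [hpty _ _]free_liftE /hpty_gen.
case: pselect => [p|_]; last exact: rpred0.
by case: cid2 => e' _ /= e'E; apply: span_gen; rewrite -(wt_f0 ord0) e'E.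
Qed.

Lemma face_sum0_up n (e : B n.+2) : face_sum f0 n.+1 (free_gen e) =
  free_gen (f0 ord0 e)
  - \sum_(k < n.+1) free_gen (f0 (fintype.lift ord0 k) e) *~ (-1) ^+ k.
Proof.
rewrite face_sumE big_ord_recl expr0 mulr1z -sumrN; congr (_ + _).
by apply: eq_bigr => k _; rewrite /= exprS mulN1r mulrNz.
Qed.

(** Without the faces f1, [hpty] is an exact contraction in positive degrees.
If e is up, its faces other than f0 ord0 e are up, hence killed by [hpty].  If
e = f0 ord0 e' with e' up, the faces of e' other than e are the partners of the
faces of e, and they cancel by the precubical identity. *)
Lemma face_sum0_hpty n (e : B n.+1) :
  face_sum f0 n.+1 (hpty n.+1 (free_gen e)) + hpty n (face_sum f0 n (free_gen e))
  = free_gen e.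
Proof.
have [ue|[e' ue' <-]] := up_or_collapses e.
  rewrite hpty_up // raddf0 add0r face_sumE big_ord_recl expr0 mulr1z raddfD.
  rewrite hpty_collapse // raddf_sum big1 ?addr0 // => k _.
  case: n e ue k => [|n] e ue k; first by case: k.
  by rewrite raddfMz hpty_up ?mul0rz //; exact: up_f0.
rewrite hpty_collapse // face_sum0_up face_sumE (raddf_sum (hpty n)).
rewrite -[RHS]addr0 -addrA; congr (_ + _).
apply/eqP; rewrite addrC subr_eq0; apply/eqP.
apply: eq_bigr => k _; rewrite raddfMz; congr (_ *~ _).
have [//|//|//|_ _ _ <-] := @precubical n ord0 k (fintype.lift ord0 k) ord0 e'.
by rewrite hpty_collapse //; exact: up_f0.
Qed.

Lemma face_sum1_span n L x : x \in span n.+1 L.+1 -> face_sum f1 n x \in span n L.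
Proof.
apply: span_sub => e eL; rewrite face_sumE; apply: rpred_sum => k _.
by apply/rpredMz/span_gen; have := wt_f1 k e; lia.
Qed.

(** With the faces f1 added, [hpty] contracts up to smaller weight. *)
Lemma hpty_contract n L x : x \in span n.+1 L.+1 ->
  x - bdry n.+1 (hpty n.+1 x) - hpty n (bdry n x) \in span n.+1 L.
Proof.
move=> xL.
have xE : x = face_sum f0 n.+1 (hpty n.+1 x) + hpty n (face_sum f0 n x).
  pose g : {additive {freeg (B n.+1)} -> {freeg (B n.+1)}} :=
    (face_sum f0 n.+1 \o hpty n.+1) \+ (hpty n \o face_sum f0 n).
  apply: (free_ext (g := idfun) (h := g)) => e; rewrite /g /=.
  by rewrite face_sum0_hpty.
rewrite {1}xE /bdry /= (raddfB (hpty n)) !opprB -addrA [X in _ + X]addrACA -opprD.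
rewrite addrC subrK.
rewrite rpredD ?face_sum1_span ?hpty_span //.
exact: face_sum1_span.
Qed.

(** By induction on the weight: subtracting the boundary of [hpty x] from a cycle
x leaves a homologous cycle of smaller weight. *)
Lemma bdry_exact n (x : {freeg (B n.+1)}) :
  bdry n x = 0 -> exists y, bdry n.+1 y = x.
Proof.
have [L] := span_ex x; elim: L x => [|L IH] x.
  move=> x0 _; exists 0; rewrite raddf0; apply/esym/eqP.
  pose Z : zmodClosed {freeg (B n.+1)} := kerp idfun.
  exact: (span_sub (f := idfun) (P := Z) _ x0).
move=> /hpty_contract xL dx; move: xL; rewrite dx raddf0 subr0 => /IH[].
  by rewrite raddfB dx bdryK subr0.
by move=> y yE; exists (y + hpty n.+1 x); rewrite raddfD yE subrK.
Qed.

(** In weight 0 and degree 0 there is at most one cell, which is detected by the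
augmentation. *)
Lemma base_exact (x : {freeg (B 0)}) : x \in span 0 1 -> aug x = 0 -> x = 0.
Proof.
have [[e0 e00]|ne] := pselect (exists e : B 0, wt e = 0%N); last first.
  move=> x0 _.
  apply/eqP; apply: (span_sub (f := idfun) (P := kerp idfun) _ x0) => e.
  by rewrite ltnS leqn0 => /eqP e0; case: ne; exists e.
pose g : {additive {freeg (B 0)} -> {freeg (B 0)}} :=
  idfun \- (intmul (free_gen e0) \o aug).
move=> x0 augx; have : x \in kerp g.
  apply: (span_sub (f := idfun) (P := kerp g) _ x0) => e; rewrite ltnS leqn0 => /eqP e_0.
  by apply/eqP; rewrite /= free_liftE (base_uniq e_0 e00) mulr1z subrr.
by move=> /eqP; rewrite /= augx mulr0z subr0.
Qed.

Lemma bdry_exact0 (x : {freeg (B 0)}) : aug x = 0 -> exists y, bdry 0 y = x.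
Proof.
have [L /(span_le (leqnSn L))] := span_ex x.
elim: L x => [|L IH] x xL augx.
  by exists 0; rewrite raddf0 (base_exact xL augx).
pose g : {additive {freeg (B 0)} -> {freeg (B 0)}} := idfun \- (bdry 0 \o hpty 0).
have gx : g x \in span 0 L.+1.
  apply: (span_sub (f := g) _ xL) => e eL.
  change (free_gen e - bdry 0 (hpty 0 (free_gen e)) \in span 0 L.+1).
  have [e0|/collapses0[e' ue' e'E]] := eqVneq (wt e) 0%N.
    rewrite [hpty _ _]free_liftE /hpty_gen; case: pselect => [p|_].
      by have [e' _ e'E] := p; have := wt_f1 ord0 e'; rewrite -(wt_f0 ord0 e') e'E e0.
    by rewrite raddf0 subr0 span_gen // e0.
  rewrite -e'E hpty_collapse // bdryE big_ord1 mulr1z.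
  rewrite opprB addrC subrK span_gen //; have := wt_f1 ord0 e'.
  by rewrite -(wt_f0 ord0 e') e'E; lia.
have [|y yE] := IH _ gx; first by rewrite /g raddfB augx aug_bdry subr0.
by exists (y + hpty 0 x); rewrite raddfD yE subrK.
Qed.

End Precubical.

(** * Free functors and their colimits *)

Section FreeOn.
Variables (C : category) (K : choiceType) (t : K -> C).

(** The functor that is free on these sets is the coproduct of the linearized
representable functors at the objects t k. *)
Definition cell_at (b : C) := {classic {k : K & mor (t k) b}}.

Definition cell k b (f : mor (t k) b) : cell_at b :=
  existT (fun k => mor (t k) b : Type) k f.

Definition free_on_fmap b c (g : mor b c) :
    {additive {freeg (cell_at b)} -> {freeg (cell_at c)}} :=
  free_lift (fun e : cell_at b => free_gen (cell (mcomp (tagged e) g))).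

Fact free_on_fmap1 b x : free_on_fmap (idm b) x = x.
Proof.
apply: (free_ext (h := idfun)) => -[k f].
by rewrite [LHS]free_liftE /= mcompm1.
Qed.

Fact free_on_fmapM b c d (g : mor b c) (h : mor c d) x :
  free_on_fmap (mcomp g h) x = free_on_fmap h (free_on_fmap g x).
Proof.
apply: (free_ext (h := free_on_fmap h \o free_on_fmap g)) => -[k f].
by rewrite [LHS]free_liftE [RHS]/= !free_liftE /= mcompA.
Qed.

Definition free_on : ab_functor C := AbFunctor free_on_fmap1 free_on_fmapM.

Definition free_on_gen k : free_on (t k) := free_gen (cell (idm (t k))).

Lemma free_on_fmap_gen k b (f : mor (t k) b) :
  fmap free_on f (free_on_gen k) = free_gen (cell f).
Proof. by rewrite [LHS]free_liftE /= mcomp1m. Qed.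

(** By the Yoneda lemma, a transformation from the free functor is a choice of
images for the generators. *)
Section Desc.
Variables (F : ab_functor C) (x : forall k, F (t k)).

Fact free_on_desc_natural b c (g : mor b c) (y : free_on b) :
  free_lift (fun e : cell_at c => fmap F (tagged e) (x (tag e))) (fmap free_on g y)
  = fmap F g (free_lift (fun e : cell_at b => fmap F (tagged e) (x (tag e))) y).
Proof.
apply: (free_ext (g := free_lift _ \o fmap free_on g)
  (h := fmap F g \o free_lift _)) => -[k f] /=.
by rewrite [free_on_fmap _ _]free_liftE !free_liftE /= fmapM.
Qed.

Definition free_on_desc : nat_trans free_on F :=
  NatTrans (fun b c g => free_on_desc_natural (b := b) (c := c) g).

Lemma free_on_descE k b (f : mor (t k) b) :
  free_on_desc b (free_gen (cell f)) = fmap F f (x k).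
Proof. exact: free_liftE. Qed.

End Desc.

Lemma free_on_ext (F : ab_functor C) (u v : nat_trans free_on F) :
  (forall k, u (t k) (free_on_gen k) = v (t k) (free_on_gen k)) ->
  forall b x, u b x = v b x.
Proof.
move=> uv b; apply: free_ext => -[k f].
by rewrite -[existT _ _ _]/(cell f) -free_on_fmap_gen !naturality uv.
Qed.

Lemma free_on_projective : projective free_on.
Proof.
move=> G H e u e_epi.
pose l k := cid (e_epi (t k) (u (t k) (free_on_gen k))).
exists (free_on_desc (fun k => sval (l k))).
apply: (free_on_ext (u := ntrans_comp _ _)) => k /=.
by rewrite free_liftE /= fmap1; exact: svalP (l k).
Qed.

(** The colimit identifies all cells over the same generator k, since each is the
image of the identity cell at t k. *)
Definition colim_free_on : {additive colim free_on -> {freeg K}} :=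
  colim_desc (free_on_desc (F := const_functor C {freeg K}) (@free_gen K)).

Lemma colim_free_onE k b (f : mor (t k) b) :
  colim_free_on (colim_in (free_gen (cell f) : free_on b)) = free_gen k.
Proof. by rewrite [LHS]colim_descE free_on_descE. Qed.

Definition colim_free_on_inv : {additive {freeg K} -> colim free_on} :=
  free_lift (fun k => colim_in (free_on_gen k)).

Lemma colim_free_onK : cancel colim_free_on colim_free_on_inv.
Proof.
pose g := colim_free_on_inv \o colim_free_on.
apply: (colim_ext (g := g) (h := idfun)) => b.
pose i : {additive free_on b -> colim free_on} := @colim_in C free_on b.
apply: (@free_ext (cell_at b) _ (g \o i) i) => -[k f].
change (colim_free_on_inv (colim_free_on (colim_in (free_gen (cell f) : free_on b)))
  = colim_in (free_gen (cell f) : free_on b)).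
by rewrite colim_free_onE [LHS]free_liftE -free_on_fmap_gen colim_in_natural.
Qed.

Lemma colim_free_on_invK : cancel colim_free_on_inv colim_free_on.
Proof.
apply: (free_ext (g := colim_free_on \o colim_free_on_inv) (h := idfun)) => k.
change (colim_free_on (colim_free_on_inv (free_gen k)) = free_gen k).
by rewrite [X in colim_free_on X]free_liftE colim_free_onE.
Qed.

End FreeOn.

Lemma isomorphic_trans (A B D : zmodType) :
  isomorphic A B -> isomorphic B D -> isomorphic A D.
Proof. by move=> [f f_bij] [g g_bij]; exists (g \o f); exact: bij_comp. Qed.

Lemma homology_iso (X Y : chain_complex) (f : forall n, {additive X n -> Y n})
    (g : forall n, {additive Y n -> X n}) :
  (forall n, cancel (f n) (g n)) -> (forall n, cancel (g n) (f n)) ->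
  (forall n x, f n (chain_diff X n x) = chain_diff Y n (f n.+1 x)) ->
  forall n, isomorphic (homology X n) (homology Y n).
Proof.
move=> fK gK f_diff n.
have g_diff m x : g m (chain_diff Y m x) = chain_diff X m (g m.+1 x).
  by apply: (can_inj (fK m)); rewrite gK f_diff gK.
exists (homology_map f_diff (n := n)), (homology_map g_diff (n := n));
  apply: homology_map_can => x _; exists 0.
  by rewrite fK raddf0 subrr.
by rewrite gK raddf0 subrr.
Qed.

(** * The resolution by cells *)

Section Resolution.
Variables (disp : Order.disp_t) (E : orderType disp) (I : rel E).
Variables (S : choiceType) (X : state_space I S).
Hypothesis I_sym : symmetric I.

(** The default value of [odflt] is never taken: see [top_stateE]. *)
Definition top_state n (q : Qbar X n) : state_category X :=
  odflt (sval q).1 (X (sval q).1 (trace_of I (sval q).2)).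

Lemma top_stateE n (q : Qbar X n) :
  X (sval q).1 (trace_of I (sval q).2) = Some (top_state q).
Proof.
by rewrite /top_state; case: q => -[s t] /= /andP[_] /=; case: (X s _).
Qed.

Fact edge0_subproof n (k : 'I_n.+1) (q : Qbar X n.+1) :
  X (top_state (face0 k q)) (letter I (tnth (sval q).2 k)) == Some (top_state q).
Proof.
have := top_stateE q; have := top_stateE (face0 k q).
case: q => -[s t] st /= f0E; rewrite (trace_del_letterr st k) pactM f0E /=.
by move=> ->.
Qed.

(** The face that keeps the source misses the last step of the cube, so its top
state precedes that of the cube by one letter. *)
Definition edge0 n (k : 'I_n.+1) (q : Qbar X n.+1) :
    mor (top_state (face0 k q)) (top_state q) :=
  exist (fun w => X (top_state (face0 k q)) w == Some (top_state q))
    (letter I (tnth (sval q).2 k)) (edge0_subproof k q).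

Fact edge1_subproof n (k : 'I_n.+1) (q : Qbar X n.+1) :
  X (top_state (face1 k q)) 1%g == Some (top_state q).
Proof.
apply/eqP; rewrite pact1 -(top_stateE q) -(top_stateE (face1 k q)).
case: q => -[s t] st /=.
by rewrite (trace_del_letterl st k) pactM (stepE st).
Qed.

(** The face that moves the source has the same top state as the cube, but only
propositionally: hence an arrow over the trivial trace. *)
Definition edge1 n (k : 'I_n.+1) (q : Qbar X n.+1) :
    mor (top_state (face1 k q)) (top_state q) :=
  exist (fun w => X (top_state (face1 k q)) w == Some (top_state q))
    1%g (edge1_subproof k q).

Section Cells.
Variable b : state_category X.

Definition cells n : choiceType := cell_at (@top_state n) b.

Definition cell_face0 n (k : 'I_n.+1) (e : cells n.+1) : cells n :=
  cell (t := @top_state n) (mcomp (edge0 k (tag e)) (tagged e)).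

Definition cell_face1 n (k : 'I_n.+1) (e : cells n.+1) : cells n :=
  cell (t := @top_state n) (mcomp (edge1 k (tag e)) (tagged e)).

Definition source n (e : cells n) : S := (sval (tag e)).1.
Definition clique n (e : cells n) : n.-tuple E := (sval (tag e)).2.
Definition tail n (e : cells n) : trace_monoid I := sval (tagged e).
Definition total n (e : cells n) : trace_monoid I := (trace_of I (clique e) * tail e)%g.

Lemma cell_eq n (e e' : cells n) :
  source e = source e' -> clique e = clique e' -> tail e = tail e' -> e = e'.
Proof.
case: e => -[[s t] st] [w wE]; case: e' => -[[s' t'] st'] [w' wE'].
rewrite /source /clique /tail /= => ss tt ww; subst s' t' w'.
have ? : st' = st by exact: bool_irrelevance.
subst st'; have ? : wE' = wE by exact: bool_irrelevance.
by subst wE'.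
Qed.

Lemma cell_ex n s (t : n.-tuple E) w :
    pairwise (fun a b => (a < b)%O && I a b) t ->
    X s (trace_of I t * w)%g = Some b ->
  exists e : cells n, [/\ source e = s, clique e = t & tail e = w].
Proof.
move=> tI; rewrite pactM => /eqP wE.
have st : is_Qbar X (s, t) by rewrite /is_Qbar /= tI; case: (X s _) wE.
pose q := mkQbar st.
have wE' : X (top_state q) w == Some b.
  by move: wE; rewrite -[X s _]/(X (sval q).1 (trace_of I (sval q).2)) top_stateE.
by exists (cell (t := @top_state n) (exist _ w wE' : mor (top_state q) b)).
Qed.

Lemma total_end n (e : cells n) : X (source e) (total e) = Some b.
Proof.
by rewrite pactM (top_stateE (tag e)) /=; exact/eqP/(svalP (tagged e)).
Qed.

Lemma clique_pairwise n (e : cells n) :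
  pairwise (fun a b => (a < b)%O && I a b) (clique e).
Proof. by case: e => -[[s t] st] w; case/andP: (st). Qed.

Lemma clique_lt n (e : cells n) (i j : 'I_n) : (i < j)%N ->
  (tnth (clique e) i < tnth (clique e) j)%O && I (tnth (clique e) i) (tnth (clique e) j).
Proof.
have a0 := tnth (clique e) i; have /(pairwiseP a0) := clique_pairwise e.
by move=> /(_ i j); rewrite !inE !size_tuple !ltn_ord -!tnth_nth; exact.
Qed.

Lemma total_lettersl n (k : 'I_n.+1) (e : cells n.+1) :
  total e = (letter I (tnth (clique e) k)
    * (trace_of I (del_letter k (clique e)) * tail e))%g.
Proof.
rewrite mulgA; congr (_ * _)%g.
by case: e => -[[s t] st] w; exact: (trace_del_letterl st k).
Qed.

Lemma clique_face0 n (k : 'I_n.+1) (e : cells n.+1) :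
  clique (cell_face0 k e) = del_letter k (clique e).
Proof. by case: e => -[[]]. Qed.

Lemma source_face0 n (k : 'I_n.+1) (e : cells n.+1) :
  source (cell_face0 k e) = source e.
Proof. by case: e => -[[]]. Qed.

Lemma tail_face0 n (k : 'I_n.+1) (e : cells n.+1) :
  tail (cell_face0 k e) = (letter I (tnth (clique e) k) * tail e)%g.
Proof. by []. Qed.

Lemma total_face0 n (k : 'I_n.+1) (e : cells n.+1) :
  total (cell_face0 k e) = total e.
Proof.
rewrite /total tail_face0 clique_face0 mulgA; congr (_ * _)%g.
by case: e => -[[s t] st] w; rewrite [RHS](trace_del_letterr st k).
Qed.

Lemma clique_face1 n (k : 'I_n.+1) (e : cells n.+1) :
  clique (cell_face1 k e) = del_letter k (clique e).
Proof. by case: e => -[[]]. Qed.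

Lemma tail_face1 n (k : 'I_n.+1) (e : cells n.+1) :
  tail (cell_face1 k e) = tail e.
Proof. exact: mul1g. Qed.

(** The quantity that separates the two families of faces: [weight_face0] and
[weight_face1]. *)
Definition weight n (e : cells n) : nat := trace_size (total e).

Lemma weight_face0 n (k : 'I_n.+1) (e : cells n.+1) :
  weight (cell_face0 k e) = weight e.
Proof. by rewrite /weight total_face0. Qed.

Lemma weight_face1 n (k : 'I_n.+1) (e : cells n.+1) :
  (weight (cell_face1 k e) < weight e)%N.
Proof.
rewrite /weight (total_lettersl k) trace_size_letterM /total.
by rewrite clique_face1 tail_face1.
Qed.

Lemma cell_precubical n (k k' : 'I_n.+1) (j j' : 'I_n.+2) (e : cells n.+2) :
  (k < j)%N -> j = k'.+1 :> nat -> k = j' :> nat ->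
  [/\ cell_face1 k (cell_face1 j e) = cell_face1 k' (cell_face1 j' e),
      cell_face1 k (cell_face0 j e) = cell_face0 k' (cell_face1 j' e),
      cell_face0 k (cell_face1 j e) = cell_face1 k' (cell_face0 j' e)
    & cell_face0 k (cell_face0 j e) = cell_face0 k' (cell_face0 j' e)].
Proof.
move=> kj jk kk; have [H1 H2 H3 H4] := face_face kj jk kk (tag e).
have dd := del_letterC kj jk kk (clique e).
have td := tnth_del_letter kj jk kk (clique e).
split; apply: cell_eq.
- by rewrite /source /= H1.
- by rewrite /clique /= H1.
- by rewrite !tail_face1.
- by rewrite /source /= H2.
- by rewrite /clique /= H2.
- by rewrite tail_face1 !tail_face0 clique_face1 tail_face1 td.
- by rewrite /source /= H3.
- by rewrite /clique /= H3.
- by rewrite tail_face1 !tail_face0 clique_face1 tail_face1 td.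
- by rewrite /source /= H4.
- by rewrite /clique /= H4.
rewrite !tail_face0 !clique_face0 !td !mulgA letterC //.
have j'j : (j' < j)%N by rewrite -kk.
by case/andP: (clique_lt e j'j).
Qed.

(** The matching: the least leading letter of the total trace is in the clique.
As the clique is increasing and its letters all lead the total trace, this
letter can only be the first one. *)
Definition head_least n (e : cells n.+1) : Prop :=
  least_lead (tnth (clique e) ord0) (total e).

Lemma leads_clique n (k : 'I_n.+1) (e : cells n.+1) :
  leads (tnth (clique e) k) (total e).
Proof. by rewrite (total_lettersl k); exact: leads_letterM. Qed.

Lemma del_letter0 n (t : n.+1.-tuple E) : del_letter ord0 t = behead t :> seq E.
Proof. by rewrite val_del_letter take0 drop1. Qed.

Lemma head_least_face0 n (k : 'I_n.+1) (e : cells n.+2) :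
  head_least e -> head_least (cell_face0 (fintype.lift ord0 k) e).
Proof.
rewrite /head_least total_face0 clique_face0 tnth_mktuple.
by congr (least_lead (tnth _ _) _); exact: val_inj.
Qed.

Lemma head_least_inj n (e e' : cells n.+1) : head_least e -> head_least e' ->
  cell_face0 ord0 e = cell_face0 ord0 e' -> e = e'.
Proof.
move=> ee ee' f0E.
have totE : total e = total e' by rewrite -(total_face0 ord0) f0E total_face0.
have hE : tnth (clique e) ord0 = tnth (clique e') ord0.
  by apply: least_lead_uniq ee _; rewrite totE.
apply: cell_eq.
- by have := congr1 (@source n) f0E; rewrite !source_face0.
- have := congr1 (fun x => val (clique x)) f0E; rewrite /= !clique_face0 !del_letter0.
  move: hE; rewrite (tuple_eta (clique e)) (tuple_eta (clique e')) !tnth0 /= => h1 h2.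
  by apply: val_inj; rewrite /= h1 h2.
have := congr1 (@tail n) f0E; rewrite !tail_face0 hE.
exact: letter_cancel.
Qed.

Lemma head_least_not_collapses n (e : cells n.+1) :
  head_least e -> ~ collapses cell_face0 head_least e.
Proof.
move=> ee [e' ee' e'E].
have hE : tnth (clique e) ord0 = tnth (clique e') ord0.
  by apply: least_lead_uniq ee _; rewrite -e'E total_face0.
move: hE; rewrite -e'E clique_face0 tnth_mktuple => hE.
by have := @clique_lt _ e' ord0 (fintype.lift ord0 ord0) isT; rewrite hE ltxx.
Qed.

(** If the least leading letter m of the total trace is not in the clique, it
commutes with the clique and divides the tail, so it can be moved from the tail
to the front of the clique. *)
Lemma collapses_min n (e : cells n) m : least_lead m (total e) ->
  m \notin (clique e : seq E) -> collapses cell_face0 head_least e.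
Proof.
move=> mm me; have [mt mw] := leads_cat I_sym me mm.1.
have wE := leads_strip mw; set w' := strip m _ in wE.
have tE : (trace_of I (m :: clique e) * w')%g = total e.
  by rewrite trace_of_cons -(letter_commute mt) -mulgA -wE.
have [||e' [se ce te]] := @cell_ex n.+1 (source e) [tuple of m :: clique e] w'.
- rewrite /= clique_pairwise andbT; apply/allP => a ae; rewrite (allP mt) // andbT.
  rewrite lt_neqAle; apply/andP; split; first by apply: contraNneq me => ->.
  have /tnthP[k ->] := ae; apply: mm.2.
  by case: n e k {mm me mt mw wE w' tE ae} => [|n] e k; [case: k|exact: leads_clique].
- by rewrite tE total_end.
have totE : total e' = total e by rewrite /total ce te.
exists e'; first by rewrite /head_least totE ce tnth0.
apply: cell_eq.
- by rewrite source_face0.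
- by apply: val_inj; rewrite /= clique_face0 del_letter0 ce.
by rewrite tail_face0 ce te tnth0 -wE.
Qed.

Lemma head_least_or_collapses n (e : cells n.+1) :
  head_least e \/ collapses cell_face0 head_least e.
Proof.
have [m mm] : exists m, least_lead m (total e).
  by apply: least_lead_ex; rewrite (total_lettersl ord0) trace_size_letterM.
have [me|me] := boolP (m \in (clique e : seq E)); last by right; exact: collapses_min me.
left; rewrite /head_least; suff -> : tnth (clique e) ord0 = m by [].
apply/le_anti; rewrite (mm.2 _ (leads_clique _ _)) andbT.
have := clique_pairwise e; move: me; rewrite (tuple_eta (clique e)) tnth0 /= inE.
by case/predU1P=> [->//|mt] /andP[/allP/(_ _ mt)/andP[/ltW]].
Qed.

Lemma weight_collapses (e : cells 0) : weight e != 0%N ->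
  collapses cell_face0 head_least e.
Proof.
by move/least_lead_ex=> [m mm]; apply: collapses_min mm _; rewrite tuple0.
Qed.

Lemma weight0_uniq (e e' : cells 0) : weight e = 0%N -> weight e' = 0%N -> e = e'.
Proof.
have w0 (f : cells 0) : weight f = 0%N -> source f = b /\ tail f = 1%g.
  move=> /trace_size_eq0 f1; have := total_end f; rewrite f1 pact1 => -[]; split=> //.
  by rewrite -f1 /total tuple0 /= -/(trace_one I) [RHS]trace_mul1.
move=> /w0[s w] /w0[s' w']; apply: cell_eq; rewrite ?s ?w //.
by rewrite [LHS]tuple0 [RHS]tuple0.
Qed.

End Cells.

Definition cell_diff n :
    nat_trans (free_on (@top_state n.+1)) (free_on (@top_state n)) :=
  free_on_desc (F := free_on (@top_state n)) (fun q : Qbar X n.+1 =>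
    \sum_(k < n.+1) (free_gen (cell (edge0 k q)) - free_gen (cell (edge1 k q)))
      *~ (-1) ^+ k).

Definition cell_aug :
    nat_trans (free_on (@top_state 0)) (const_functor (state_category X) int) :=
  free_on_desc (F := const_functor (state_category X) int) (fun=> 1).

Lemma cell_diffE b n (x : {freeg (cells b n.+1)}) :
  cell_diff n b x = bdry (@cell_face0 b) (@cell_face1 b) n x.
Proof.
apply: (free_ext (g := cell_diff n b)) => -[q w].
rewrite -[existT _ _ _]/(cell (w : mor (top_state q) b)).
rewrite bdryE [LHS]free_on_descE raddf_sum; apply: eq_bigr => k _.
by rewrite raddfMz raddfB; congr ((_ - _) *~ _); exact: free_liftE.
Qed.

Lemma cell_augE b (x : {freeg (cells b 0)}) : cell_aug b x = aug (@cells b) x.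
Proof.
apply: (free_ext (g := cell_aug b)) => -[q w].
rewrite -[existT _ _ _]/(cell (w : mor (top_state q) b)).
by rewrite [LHS]free_on_descE [RHS]free_liftE.
Qed.

Lemma cell_aug_surj : pointwise_surj cell_aug.
Proof.
move=> b z; have [//||e _] := @cell_ex b 0 b [tuple] 1%g.
  by rewrite /= -/(trace_one I) -[trace_one I]/(1%g : trace_monoid I) mulg1 pact1.
exists (free_gen e *~ z); rewrite raddfMz cell_augE [aug _ _]free_liftE.
by rewrite intz.
Qed.

Lemma cell_exact0 : exact_at (cell_diff 0) cell_aug.
Proof.
move=> b y; rewrite cell_augE; split=> [y0|[x <-]]; last first.
  by rewrite cell_diffE; exact: aug_bdry.
have [x <-] := bdry_exact0 (@weight_face0 b) (@weight_face1 b) (@head_least_inj b)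
  (@weight_collapses b) (@weight0_uniq b) y0.
by exists x; rewrite cell_diffE.
Qed.

Lemma cell_exact n : exact_at (cell_diff n.+1) (cell_diff n).
Proof.
move=> b y; rewrite cell_diffE; split=> [y0|[x <-]]; last first.
  by rewrite cell_diffE; exact: (bdryK (@cell_precubical b)).
have [x <-] := bdry_exact (@cell_precubical b) (@weight_face0 b) (@weight_face1 b)
  (@head_least_face0 b) (@head_least_inj b) (@head_least_not_collapses b)
  (@head_least_or_collapses b) y0.
by exists x; rewrite cell_diffE.
Qed.

Definition cell_resolution :
    projective_resolution (const_functor (state_category X) int) :=
  @ProjResolution _ _ (fun n => free_on (@top_state n)) cell_diff cell_aug
    (fun n => @free_on_projective _ _ (@top_state n))
    cell_aug_surj cell_exact0 cell_exact.

(** The colimit forgets the tails, hence turns the two faces of a cell into those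
of the underlying cube. *)
Lemma colim_cell_diff n (x : colim (free_on (@top_state n.+1))) :
  colim_free_on (@top_state n) (colim_map (cell_diff n) x)
  = Qbar_diff X n (colim_free_on (@top_state n.+1) x).
Proof.
pose g := colim_free_on (@top_state n) \o colim_map (cell_diff n).
pose h := Qbar_diff X n \o colim_free_on (@top_state n.+1).
apply: (colim_ext (g := g) (h := h)) => b y.
pose i : {additive free_on (@top_state n.+1) b -> colim (free_on (@top_state n.+1))} :=
  @colim_in _ (free_on (@top_state n.+1)) b.
apply: (@free_ext (cells b n.+1) _ (g \o i) (h \o i)) => -[q w].
set e : mor (top_state q) b := w.
change (colim_free_on (@top_state n) (colim_map (cell_diff n)
    (colim_in (free_gen (cell e) : free_on (@top_state n.+1) b)))
  = Qbar_diff X n (colim_free_on (@top_state n.+1)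
    (colim_in (free_gen (cell e) : free_on (@top_state n.+1) b)))).
rewrite colim_mapE colim_free_onE Qbar_diffE cell_diffE bdryE.
rewrite -sumrN !raddf_sum; apply: eq_bigr => k _.
rewrite -mulNrz opprB !raddfMz !raddfB; congr ((_ - _) *~ _); exact: colim_free_onE.
Qed.

End Resolution.

Theorem theorem3p10 (disp : Order.disp_t) (E : orderType disp) (I : rel E)
    (S : choiceType) (X : state_space I S)
    (I_irreflexive : irreflexive I) (I_symmetric : symmetric I) (n : nat) :
  isomorphic (left_derived_colim n (const_functor (state_category X) int))
             (homology (Qbar_complex X) n).
Proof.
apply: isomorphic_trans (left_derived_colimE (cell_resolution X I_symmetric) n) _.
apply: (homology_iso (X := colim_complex (cell_resolution X I_symmetric))
  (Y := Qbar_complex X) (f := fun n => colim_free_on (@top_state _ _ _ _ X n))).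
- by move=> m; exact: colim_free_onK.
- by move=> m; exact: colim_free_on_invK.
by move=> m x; exact: colim_cell_diff.
Qed.
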